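(* Let $1\le k\le n$, let $\Omega=I_1\times\dots\times I_n\subset\mathbb{R}^n$ be a rectangular domain (a product of open intervals), and let $B:\Omega\to\mathbb{R}$ be a smooth, locally bounded function (i.e. bounded on bounded subsets of $\Omega$). Let $A=(a_1,\dots,a_n)$ be a real $k\times n$ matrix of full rank $k$ whose columns $a_i\in\mathbb{R}^k$ satisfy $\|a_i\|=1$ for $i=1,\dots,n$. Then $$A^*A\bullet \mathrm{Hess}\,B(u)\le 0\quad\text{for all }u\in\Omega$$ if and only if $$\int_{\mathbb{R}^k} B(u_1(a_1\cdot x),\dots,u_n(a_n\cdot x))\,d\gamma_k(x)\le B\left(\int_{\mathbb{R}}u_1\,d\gamma_1,\dots,\int_{\mathbb{R}}u_n\,d\gamma_1\right)$$ for all smooth bounded functions $u_j:\mathbb{R}\to I_j$, $j=1,\dots,n$.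
   Context: $\gamma_s$ denotes the standard Gaussian measure on $\mathbb{R}^s$, $d\gamma_s(x)=(2\pi)^{-s/2}e^{-|x|^2/2}dx$. For matrices $M_1,M_2$ of the same size, $M_1\bullet M_2$ is the entrywise (Schur) product, so $A^*A\bullet\mathrm{Hess}\,B$ is the $n\times n$ matrix with entries $\langle a_i,a_j\rangle\,\partial_{ij}B$. For a symmetric matrix $M$, $M\le 0$ means that $M$ is negative semidefinite. *)

(* Defs.v *)
From HB Require Import structures.
From mathcomp Require Import all_boot all_order all_algebra.
From mathcomp Require Import all_classical all_reals all_analysis.
From mathcomp Require Import measurable_realfun.

Set Implicit Arguments.
Unset Strict Implicit.
Unset Printing Implicit Defensive.

Import Order.TTheory GRing.Theory Num.Theory.
Import numFieldNormedType.Exports.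

Local Open Scope classical_set_scope.
Local Open Scope ring_scope.

Section Euclidean.
Context {R : realType}.

Definition dot s (v w : 'cV[R]_s) : R := \sum_i v i 0 * w i 0.

(* The library norm on matrices is the sup norm. *)
Definition enorm s (v : 'cV[R]_s) : R := Num.sqrt (dot v v).

Definition schur m n (M N : 'M[R]_(m, n)) : 'M[R]_(m, n) :=
  \matrix_(i, j) (M i j * N i j).

(* Only meaningful for symmetric [M]. *)
Definition negsemidef n (M : 'M[R]_n) : Prop :=
  forall v : 'cV[R]_n, (v^T *m M *m v) 0 0 <= 0.

End Euclidean.

Section Smoothness.
Context {R : realType} {n : nat}.
Implicit Types f : 'rV[R]_n -> R.

Definition partial (i : 'I_n) f : 'rV[R]_n -> R :=
  fun u => 'D_(delta_mx 0 i) f u.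

Definition iter_partial (s : seq 'I_n) f : 'rV[R]_n -> R := foldr partial f s.

(* C^oo on an open set: all iterated partial derivatives exist and are
   continuous there. The values of [f] outside [D] play no role. *)
Definition smooth_on (D : set 'rV[R]_n) f : Prop :=
  forall (s : seq 'I_n) (u : 'rV[R]_n), D u ->
    {for u, continuous (iter_partial s f)} /\
    forall i, derivable (iter_partial s f) u (delta_mx 0 i).

Definition locally_bounded_on (D : set 'rV[R]_n) f : Prop :=
  forall S : set 'rV[R]_n, S `<=` D -> bounded_set S -> [bounded f x | x in S].

Definition Hess f (u : 'rV[R]_n) : 'M[R]_n :=
  \matrix_(i, j) partial i (partial j f) u.

Definition box (I : 'I_n -> set R) : set 'rV[R]_n :=
  [set u | forall j, I j (u 0 j)].

End Smoothness.

Definition smooth {R : realType} (f : R -> R) : Prop :=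
  forall (m : nat) (t : R), derivable (f^`(m))%classic t 1.

(* R^s as a measure space is [s.-tuple R], which carries the product
   sigma-algebra; vectors for linear algebra are columns. *)
Section GaussianMeasure.
Context {R : realType}.
Local Notation mu := (@lebesgue_measure R).

Definition vec_of s (x : s.-tuple (measurableTypeR R)) : 'cV[R]_s :=
  \col_i (tnth x i : R).

Section cons_measure.
Variables (s : nat).
Variable nu : {sigma_finite_measure set (s.-tuple (measurableTypeR R)) -> \bar R}.

Definition cons_pair (p : measurableTypeR R * s.-tuple (measurableTypeR R)) :
  s.+1.-tuple (measurableTypeR R) := [the s.+1.-tuple _ of p.1 :: p.2].

Lemma measurable_cons_pair : measurable_fun [set: _] cons_pair.
Proof. exact: measurable_cons measurable_fst measurable_snd. Qed.

Definition cons_measure : set (s.+1.-tuple (measurableTypeR R)) -> \bar R :=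
  pushforward (mu \x nu)%E cons_pair.

Let cons_measure0 : cons_measure set0 = 0%E.
Proof. by rewrite /cons_measure /pushforward preimage_set0 measure0. Qed.

Let cons_measure_ge0 A : (0 <= cons_measure A)%E.
Proof. by rewrite /cons_measure /pushforward measure_ge0. Qed.

Let cons_measure_sigma_additive : semi_sigma_additive cons_measure.
Proof.
move=> F mF tF mUF; rewrite /cons_measure /pushforward preimage_bigcup.
apply: measure_semi_sigma_additive.
- by move=> n; rewrite -[X in measurable X]setTI; exact: measurable_cons_pair.
- apply/trivIsetP => /= i j _ _ ij; rewrite -preimage_setI.
  by move/trivIsetP : tF => /(_ _ _ _ _ ij) ->//; rewrite preimage_set0.
- by rewrite -preimage_bigcup -[X in measurable X]setTI;
    exact: measurable_cons_pair.
Qed.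

HB.instance Definition _ := isMeasure.Build _ _ _
  cons_measure cons_measure0 cons_measure_ge0 cons_measure_sigma_additive.

Let cons_measure_sigma_finite : sigma_finite setT cons_measure.
Proof.
have /sigma_finiteP[F [TF ndF Foo]] := sigma_finiteT mu.
have /sigma_finiteP[G [TG ndG Goo]] := sigma_finiteT nu.
pose behd (x : s.+1.-tuple (measurableTypeR R)) :
  s.-tuple (measurableTypeR R) := [tuple of behead x].
pose hd (x : s.+1.-tuple (measurableTypeR R)) : measurableTypeR R := tnth x ord0.
have mhd : measurable_fun [set: _] hd by exact: measurable_tnth.
have mbehd : measurable_fun [set: _] behd by exact: measurable_behead.
exists (fun i => hd @^-1` F i `&` behd @^-1` G i).
  rewrite predeqE => x; split=> // _.
  have [i _ Fi] : (\bigcup_i F i) (hd x) by rewrite -TF.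
  have [j _ Gj] : (\bigcup_i G i) (behd x) by rewrite -TG.
  exists (maxn i j) => //; split.
  - by have /subsetPset := ndF _ _ (leq_maxl i j); exact.
  - by have /subsetPset := ndG _ _ (leq_maxr i j); exact.
move=> i; have [mF Fioo] := Foo i; have [mG Gioo] := Goo i; split.
  by apply: measurableI; rewrite -[X in measurable X]setTI;
    [exact: mhd|exact: mbehd].
rewrite /cons_measure /pushforward.
rewrite (_ : _ @^-1` _ = F i `*` G i).
  by rewrite product_measure1E// lte_mul_pinfty// ge0_fin_numE.
apply/seteqP; split=> -[a x] /=.
  by rewrite /hd /behd /cons_pair/= (_ : [tuple of _] = x)//; exact/val_inj.
by rewrite /hd /behd /cons_pair/= (_ : [tuple of _] = x)//; exact/val_inj.
Qed.

HB.instance Definition _ := Measure_isSigmaFinite.Build _ _ _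
  cons_measure cons_measure_sigma_finite.

End cons_measure.

(* Lebesgue measure on R^s as an iterated product; R^0 is a point of mass 1. *)
Fixpoint lebesgue_tuple (s : nat) :
    {sigma_finite_measure set (s.-tuple (measurableTypeR R)) -> \bar R} :=
  if s is s'.+1 then cons_measure (lebesgue_tuple s')
  else dirac [tuple].

Definition gaussian_density s (x : s.-tuple (measurableTypeR R)) : R :=
  (2 * pi) `^ (- (s%:R / 2)) * expR (- (enorm (vec_of x) ^+ 2 / 2)).

Section gaussian_measure.
Variable s : nat.

Lemma gaussian_density_ge0 x : 0 <= @gaussian_density s x.
Proof. by rewrite mulr_ge0 ?powR_ge0 ?expR_ge0. Qed.

Lemma measurable_gaussian_density : measurable_fun setT (@gaussian_density s).
Proof.
apply: measurable_funM => //; apply: measurableT_comp => //.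
apply: measurableT_comp => //; apply: measurable_funM => //.
rewrite (_ : (fun x => _) =
  (fun x : s.-tuple (measurableTypeR R) => \sum_(i < s) tnth x i * tnth x i)).
  apply: measurable_sum => i.
  by apply: measurable_funM; exact: measurable_tnth.
apply/funext => x; rewrite /enorm sqr_sqrtr /dot.
  by apply: eq_bigr => i _; rewrite !mxE.
by apply: sumr_ge0 => i _; rewrite -expr2 sqr_ge0.
Qed.

Definition gaussian_measure (A : set (s.-tuple (measurableTypeR R))) : \bar R :=
  (\int[lebesgue_tuple s]_(x in A) (gaussian_density x)%:E)%E.

Let gaussian_measure0 : gaussian_measure set0 = 0%E.
Proof. exact: integral_set0. Qed.

Let gaussian_measure_ge0 A : (0 <= gaussian_measure A)%E.
Proof. by apply: integral_ge0 => x _; rewrite lee_fin gaussian_density_ge0. Qed.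

Let gaussian_measure_sigma_additive : semi_sigma_additive gaussian_measure.
Proof.
move=> F mF tF mUF; rewrite /gaussian_measure ge0_integral_bigcup//=.
- apply: is_cvg_ereal_nneg_natsum_cond => n _ _.
  exact: gaussian_measure_ge0.
- apply/measurable_funTS/measurable_EFinP; exact: measurable_gaussian_density.
- by move=> x _; rewrite lee_fin gaussian_density_ge0.
Qed.

HB.instance Definition _ := isMeasure.Build _ _ _ gaussian_measure
  gaussian_measure0 gaussian_measure_ge0 gaussian_measure_sigma_additive.

End gaussian_measure.
End GaussianMeasure.

(* Main.v *)
From HB Require Import structures.
Require Import Defs.
From mathcomp Require Import all_boot all_order all_algebra.
From mathcomp Require Import all_classical all_reals all_analysis.
From mathcomp Require Import measurable_realfun ring lra.
Set Implicit Arguments.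
Unset Strict Implicit.
Unset Printing Implicit Defensive.

Import Order.TTheory GRing.Theory Num.Theory.
Import numFieldNormedType.Exports.
Local Open Scope classical_set_scope.
Local Open Scope ring_scope.

(** With X a standard Gaussian vector of R^k, put, for real functions f_j,
    J(s) = E B(f_1(s a_1.X), ..., f_n(s a_n.X)) and let Q(s) be the value of B
    at the means E f_j(s Z), Z standard normal.  A second-order Taylor expansion
    gives, for f_j with bounded derivatives and values in a compact box,

      J(s) - Q(s) = (s^2/2) Var(Z) sum_ij <a_i,a_j> f_i'(0) f_j'(0) B_ij + O(s^3),

    uniformly over the class of such f_j.  Testing with f_j = p_j + d v_j sin
    and s -> 0 yields the sign of the quadratic form.  Conversely, if the form
    is nonpositive then J(s) <= Q(s) + C s^3.  As X + Y has the law of sqrt(2) X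
    and the class is stable under translation and under f |-> E f(. + s Z), a
    defect M at scale s becomes a defect at most 2M at scale sqrt(2) s; so
    J(1) <= Q(1) + 4^r C (2^-r)^3 for all r, that is J(1) <= Q(1).  General
    smooth bounded u_j are limits of u_j(m sin(t/m)), which lie in the class. *)

(** * Gaussian measures *)

(** Two doubling steps multiply the scale by 2 and the defect by 4, while halving the initial scale
    divides a cubic error by 8. This is why the expansion is pushed to third order: an error of
    order s^2 would survive the iteration unchanged. One constant must serve at every stage although
    the functions change from stage to stage. Hence the class is described by bounds alone, and
    translation and Gaussian averaging preserve these bounds with the same constants. The
    first-order terms of J and Q cancel exactly because |a_j| = 1 gives a_j.X the law of Z; the
    matrix A^*A enters as the covariance of the a_j.X. The scheme stands in for a heat-flow
    argument, which would differentiate under the integral sign. Taylor constants are uniform only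
    on compact boxes inside the domain, whereas the values of u_j may approach the ends of I_j; this
    forces the detour through u_j(m sin(t/m)). *)

Lemma integral_cst_probability d (T : measurableType d) (R : realType)
  (P : probability T R) (c : \bar R) : (\int[P]_x c = c)%E.
Proof.
rewrite -[RHS]mule1 -[in RHS](probability_setT P).
exact: (@integral_cst _ _ _ P _ measurableT c).
Qed.

(** * Integration against a density, and affine substitution *)

Section density.
Local Open Scope ereal_scope.
Context {d} {T : measurableType d} {R : realType}.
Variables mu nu : {measure set T -> \bar R}.
Variable g : T -> R.
Hypothesis mg : measurable_fun [set: T] g.
Hypothesis g0 : forall x, (0 <= g x)%R.
Hypothesis nuE : forall A, measurable A -> nu A = \int[mu]_(x in A) (g x)%:E.

Import HBNNSimple.

(** By monotone convergence both sides are limits along the increasing simple functions [h n];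
    linearity reduces these to indicators, for which the identity is [nuE]. *)
Lemma ge0_integral_density (f : T -> \bar R) :
  measurable_fun [set: T] f -> (forall x, 0 <= f x) ->
  \int[nu]_x f x = \int[mu]_x (f x * (g x)%:E).
Proof.
move=> mf f0; pose h := nnsfun_approx measurableT mf.
have mge : measurable_fun [set: T] (EFin \o g) by exact/measurable_EFinP.
have fh x : f x = limn (fun n => (h n x)%:E).
  by apply/esym/cvg_lim => //; exact: cvg_nnsfun_approx.
have hnd x : nondecreasing_seq (fun n => (h n x)%:E).
  by move=> a b ab; rewrite lee_fin; exact/lefP/nd_nnsfun_approx.
transitivity (limn (fun n => \int[nu]_x (h n x)%:E)).
  under eq_integral do rewrite fh.
  apply: monotone_convergence => //.
  - by move=> n; exact/measurable_EFinP.
  - by move=> n x _; rewrite lee_fin.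
transitivity (limn (fun n => \int[mu]_x ((h n x)%:E * (g x)%:E))); last first.
  have fgh x : f x * (g x)%:E = limn (fun n => (h n x)%:E * (g x)%:E).
    by apply/esym/cvg_lim => //; apply: cvgeZr => //; exact: cvg_nnsfun_approx.
  under [RHS]eq_integral do rewrite fgh.
  apply/esym/monotone_convergence => //.
  - by move=> n; apply: emeasurable_funM => //; exact/measurable_EFinP.
  - by move=> n x _; rewrite mule_ge0 ?lee_fin.
  - by move=> x _ a b ab; rewrite lee_wpmul2r ?lee_fin//; exact/lefP/nd_nnsfun_approx.
congr (limn _); apply/funext => n.
transitivity (\int[nu]_x
    (\sum_(y \in range (h n)) (y * \1_(h n @^-1` [set y]) x)%:E)).
  by apply: eq_integral => t _; rewrite /= fimfunE -fsumEFin.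
have indich r : measurable_fun setT (fun x => (r * \1_(h n @^-1` [set r]) x)%:E).
  by apply: (measurable_comp measurableT) => //; exact: measurable_funM.
rewrite ge0_integral_fsum//; last by move=> y x _; exact: nnfun_muleindic_ge0.
transitivity (\int[mu]_x (\sum_(y \in range (h n))
    (y * \1_(h n @^-1` [set y]) x)%:E * (g x)%:E)); last first.
  apply: eq_integral => x _.
  rewrite -ge0_mule_fsuml => [|y]; last exact: nnfun_muleindic_ge0.
  by rewrite fsumEFin // -(fimfunE _ x).
rewrite ge0_integral_fsum//; last 2 first.
- by move=> y; exact: emeasurable_funM.
- by move=> y x _; rewrite mule_ge0 ?lee_fin// -lee_fin nnfun_muleindic_ge0.
apply: eq_fsbigr => r rhn; rewrite integralZl_indic_nnsfun//.
under [RHS]eq_integral do rewrite EFinM -muleA.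
rewrite ge0_integralZl//.
- rewrite integral_indic// setIT nuE//; congr (_ * _).
  rewrite integral_mkcond; apply: eq_integral => x _.
  by rewrite epatch_indic muleC.
- by apply: emeasurable_funM => //; exact/measurable_EFinP.
- by move=> t Et; rewrite mule_ge0 ?lee_fin.
- by move: rhn; rewrite inE => -[t _ <-]; rewrite lee_fin.
Qed.

End density.

Definition pushforward_measure {d1 d2} {T1 : measurableType d1}
    {T2 : measurableType d2} {R : realType} (f : T1 -> T2)
    (mf : measurable_fun [set: T1] f) (mu : {measure set T1 -> \bar R}) :
  {measure set T2 -> \bar R}.
Proof. by refine (pushforward mu f : {measure set T2 -> \bar R}). Defined.

Section affine_change_of_variable.
Local Open Scope ereal_scope.
Context {R : realType}.
Notation mu := (@lebesgue_measure R).

Let affine (a b : R) (x : measurableTypeR R) : measurableTypeR R := (a * x + b)%R.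

Let measurable_affine a b : measurable_fun setT (affine a b).
Proof. by apply: measurable_funD => //; exact: measurable_funM. Qed.

(** Lebesgue measure is determined by its values on half-open intervals, so it is enough to compare
    lengths there. *)
Let pushforward_affine_gt0 (a b : R) : (0 < a)%R -> forall A, measurable A ->
  mu A = a%:E * pushforward mu (affine a b) A.
Proof.
move=> a0 A mA.
pose m := mscale (NngNum (ltW a0))
  (pushforward_measure (measurable_affine a b) mu).
rewrite (_ : _ * _ = m A)//.
apply: lebesgue_measure_unique => //= _ [[s t]] _ <-.
rewrite /m /mscale/= /pushforward/=.
rewrite (_ : _ @^-1` _ = `](s - b) / a, (t - b) / a]%classic)%R; last first.
  apply/seteqP; split => x/=; rewrite !in_itv/= /affine -ltrBlDr -lerBrDr.
    by rewrite ltr_pdivrMr// ler_pdivlMr// mulrC.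
  by rewrite ltr_pdivrMr// ler_pdivlMr// mulrC.
rewrite !lebesgue_measure_itv/= !lte_fin ltr_pM2r ?invr_gt0// ltrD2r.
case: ifPn => _; last by rewrite mule0.
rewrite -!EFinD -EFinM; congr EFin; field; exact: lt0r_neq0.
Qed.

Lemma ge0_integral_affine (a b : R) (f : R -> \bar R) : (a != 0)%R ->
  measurable_fun [set: R] f -> (forall x, 0 <= f x) ->
  \int[mu]_x f x = `|a|%:E * \int[mu]_x f (a * x + b)%R.
Proof.
have pos (a' b' : R) (f' : R -> \bar R) : (0 < a')%R ->
    measurable_fun [set: R] f' -> (forall x, 0 <= f' x) ->
    \int[mu]_x f' x = a'%:E * \int[mu]_x f' (a' * x + b')%R.
  move=> a0 mf f0.
  pose m := mscale (NngNum (ltW a0))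
    (pushforward_measure (measurable_affine a' b') mu).
  rewrite (eq_measure_integral m).
    rewrite /m ge0_integral_mscale//= ge0_integral_pushforward//.
  by move=> A mA _; exact: pushforward_affine_gt0.
move=> a0 mf f0; have [a_gt0|a_lt0|a_eq0] := ltgtP 0%R a; last first.
- by rewrite -a_eq0 eqxx in a0.
(* For negative [a], reflect first: Lebesgue measure is invariant under negation, and the pair (-a,
   -b) falls under the positive case. *)
- rewrite (eq_measure_integral (pushforward mu (-%R : _ -> measurableTypeR R))).
    rewrite ge0_integral_pushforward//= (pos (- a) (- b))%R ?oppr_gt0//=.
    + rewrite ltr0_norm//; congr (_ * _); apply: eq_integral => x _.
      by congr f; rewrite /=; ring.
    + exact: measurableT_comp.
  by move=> A mA _; exact/esym/lebesgue_measureN.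
- by rewrite (pos a b)// gtr0_norm.
Qed.

End affine_change_of_variable.

(** * The standard normal law and its rotation invariance *)

Section standard_normal.
Local Open Scope ereal_scope.
Context {R : realType}.
Notation mu := (@lebesgue_measure R).
Notation N := (@normal_prob R 0 1).
Notation p := (@normal_pdf R 0 1).

Lemma ge0_integral_normal (f : R -> \bar R) : measurable_fun [set: R] f ->
  (forall x, 0 <= f x) -> \int[N]_x f x = \int[mu]_x (f x * (p x)%:E).
Proof.
move=> mf f0; apply: (@ge0_integral_density _ (measurableTypeR R) R mu N p) => //.
  exact: measurable_normal_pdf.
by move=> x; exact: normal_pdf_ge0.
Qed.

Lemma normal_pdf01E (x : R) :
  p x = ((2 * pi) `^ (- 2^-1) * expR (- (x ^+ 2 / 2)))%R.
Proof.
rewrite normal_pdfE ?oner_neq0// /normal_peak /normal_fun subr0 expr1n mul1r.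
have pi2 : (0 <= pi *+ 2 :> R)%R by rewrite mulrn_wge0// pi_ge0.
by rewrite -powR12_sqrt// powRN mulr_natl mulNr.
Qed.

(* If y = (z - a x) / b, then z = a x + b y and (x - a z) / b = b x - a y, so
   that (x, y) and (z, (x - a z) / b) have the same norm. *)
Lemma normal_pdf01_rot (a b x z : R) : (a ^+ 2 + b ^+ 2 = 1)%R -> b != 0%R ->
  (p x * p (b^-1 * z + - (a / b * x)) =
   p z * p (b^-1 * x + - (a / b * z)))%R.
Proof.
move=> ab b0; rewrite !normal_pdf01E mulrACA [RHS]mulrACA -!expRD.
congr (_ * expR _)%R.
have : (a ^+ 2 = 1 - b ^+ 2)%R by rewrite -ab addrK.
move=> a2; have e (s t : R) : (- (s ^+ 2 / 2) - (b^-1 * t + - (a / b * s)) ^+ 2 / 2 =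
   - ((s ^+ 2 * b ^+ 2 + (t ^+ 2 - a * s * t *+ 2 + a ^+ 2 * s ^+ 2)) / b ^+ 2 / 2))%R.
  by field.
rewrite !e a2; congr (- (_ / _ / _))%R; ring.
Qed.

Let measurable_aff (a b : R) : measurable_fun [set: R] (fun x : R => a * x + b)%R.
Proof. by apply: measurable_funD => //; exact: measurable_funM. Qed.

(** Substitute z = a x + b y in the inner integral and exchange the integrals. By [normal_pdf01_rot]
    the joint density then splits off [p z], and the remaining factor integrates to 1 in x. *)
Lemma normal_rotation (a b : R) (f : R -> \bar R) :
  (a ^+ 2 + b ^+ 2 = 1)%R -> measurable_fun [set: R] f ->
  (forall x, 0 <= f x) ->
  \int[N]_x \int[N]_y f (a * x + b * y)%R = \int[N]_x f x.
Proof.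
move=> ab mf f0.
have p0 x : 0 <= (p x)%:E by rewrite lee_fin normal_pdf_ge0.
have mp : measurable_fun [set: R] (EFin \o p).
  by apply/measurable_EFinP; exact: measurable_normal_pdf.
(* The substitution divides by [b]. When [b] vanishes, [a] is 1 or -1 and evenness of the density
   suffices. *)
have [b0|b0] := eqVneq b 0%R.
  have pN x : p (- x)%R = p x by rewrite !normal_pdf01E sqrrN.
  have a1 : a = 1%R \/ a = (-1)%R.
    by have /eqP := ab; rewrite b0 expr0n addr0 sqrf_eq1 => /orP[]/eqP; [left|right].
  transitivity (\int[N]_x f (a * x)%R).
    apply: eq_integral => x _.
    rewrite -[RHS](integral_cst_probability N).
    by apply: eq_integral => y _; rewrite b0 mul0r addr0.
  case: a1 => ->; first by apply: eq_integral => x _; rewrite mul1r.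
  have mfN : measurable_fun [set: R] (fun x => f (-1 * x)%R).
    by apply: (measurableT_comp mf); exact: measurable_funM.
  rewrite !ge0_integral_normal// [RHS](@ge0_integral_affine _ (-1) 0)//.
  - rewrite normrN1 mul1e; apply: eq_integral => x _.
    by rewrite addr0 mulN1r pN.
  - exact: emeasurable_funM.
  - by move=> x; rewrite mule_ge0.
(* [q x z] is the density at y, written in terms of z = a x + b y. *)
pose q (x z : R) : \bar R := (p (b^-1 * z + - (a / b * x))%R)%:E.
have q0 x z : 0 <= q x z by exact: p0.
have b10 : 0 <= `|b^-1|%:E by rewrite lee_fin.
have mqr x : measurable_fun [set: R] (q x).
  by apply: (measurableT_comp mp); exact: measurable_aff.
have mfq x : measurable_fun [set: measurableTypeR R] (fun z => f z * q x z).
  by apply: emeasurable_funM; [exact: mf|exact: mqr].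
have mh : measurable_fun setT (fun xz : measurableTypeR R * measurableTypeR R =>
    (p xz.1)%:E * (`|b^-1|%:E * (f xz.2 * q xz.1 xz.2))).
  apply: emeasurable_funM; first exact: (measurableT_comp mp).
  apply: emeasurable_funM => //; apply: emeasurable_funM.
    exact: (measurableT_comp mf).
  apply: (measurableT_comp mp); apply: measurable_funD.
    by apply: measurable_funM => //; exact: measurable_snd.
  apply: measurableT_comp => //.
  by apply: measurable_funM => //; exact: measurable_fst.
have mF : measurable_fun setT
    (fun xy : measurableTypeR R * measurableTypeR R => f (a * xy.1 + b * xy.2)%R).
  apply: (measurableT_comp mf); apply: measurable_funD.
    by apply: measurable_funM => //; exact: measurable_fst.
  by apply: measurable_funM => //; exact: measurable_snd.
transitivity (\int[mu]_x \int[mu]_z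
   ((p x)%:E * (`|b^-1|%:E * (f z * q x z)))).
  rewrite ge0_integral_normal//; last 2 first.
  - by have := @measurable_fun_fubini_tonelli_F _ _ (measurableTypeR R) (measurableTypeR R) R N _ mF; apply.
  - by move=> x; exact: integral_ge0.
  apply: eq_integral => x _.
  have mfx : measurable_fun [set: R] (fun y => f (a * x + b * y)%R).
    by apply: (measurableT_comp mf); apply: measurable_funD => //;
      exact: measurable_funM.
  rewrite ge0_integral_normal//.
  rewrite (@ge0_integral_affine _ b^-1 (- (a / b * x))) ?invr_eq0//; last 2 first.
  - exact: emeasurable_funM.
  - by move=> y; rewrite mule_ge0.
  rewrite muleC ge0_integralZl//; last 2 first.
  - by apply: emeasurable_funM => //; exact: mfq.
  - by move=> z _; rewrite !mule_ge0.
  rewrite ge0_integralZl//; last by move=> z _; rewrite mule_ge0.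
  congr (_ * (_ * _)); apply: eq_integral => z _; congr (f _ * _).
  by field.
apply: (etrans (@fubini_tonelli _ _ (measurableTypeR R) (measurableTypeR R) R
    mu mu (fun xz => (p xz.1)%:E * (`|b^-1|%:E * (f xz.2 * q xz.1 xz.2))) _ _)).
- exact: mh.
- by move=> [x z]; rewrite !mule_ge0.
rewrite ge0_integral_normal//; apply: eq_integral => z _.
transitivity (\int[mu]_x (f z * (p z)%:E * (`|b^-1|%:E * q z x))).
  apply: eq_integral => x _ /=.
  rewrite muleCA [in LHS](muleCA (p x)%:E) -EFinM normal_pdf01_rot// EFinM.
  by rewrite [RHS]muleCA !muleA.
have mqz : measurable_fun [set: measurableTypeR R] (q z) by exact: mqr.
rewrite ge0_integralZl//; last 3 first.
- exact: emeasurable_funM.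
- by move=> x _; rewrite mule_ge0.
- by rewrite mule_ge0.
rewrite ge0_integralZl// -(@ge0_integral_affine _ b^-1 (- (a / b * z)) (EFin \o p)) ?invr_eq0//.
by rewrite integral_normal_pdf mule1.
Qed.
End standard_normal.

(** * The Gaussian measure as an iterated normal integral *)

Section gaussian_product.
Local Open Scope ereal_scope.
Context {R : realType}.
Notation mu := (@lebesgue_measure R).
Notation N := (@normal_prob R 0 1).
Notation p := (@normal_pdf R 0 1).
Notation tup s := (s.-tuple (measurableTypeR R)).
Notation G s := (@gaussian_measure R s).

Lemma tnth_cons_pair0 s (x : measurableTypeR R) (y : tup s) :
  tnth (cons_pair (x, y)) ord0 = x.
Proof. by []. Qed.

Lemma tnth_cons_pairS s (x : measurableTypeR R) (y : tup s) i :
  tnth (cons_pair (x, y)) (lift ord0 i) = tnth y i.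
Proof. by rewrite /cons_pair/= tnthS. Qed.

Lemma dot_vec_of_cons s (a : 'cV[R]_s.+1) x (y : tup s) :
  (dot a (vec_of (cons_pair (x, y))) =
   a 0 0 * x + dot (\col_i a (lift ord0 i) 0) (vec_of y))%R.
Proof.
rewrite /dot big_ord_recl !mxE tnth_cons_pair0; congr (_ + _)%R.
by apply: eq_bigr => i _; rewrite !mxE tnth_cons_pairS.
Qed.

Lemma dot_ge0 s (a : 'cV[R]_s) : (0 <= dot a a)%R.
Proof. by apply: sumr_ge0 => i _; rewrite -expr2 sqr_ge0. Qed.

Lemma sqr_enorm s (a : 'cV[R]_s) : (enorm a ^+ 2 = dot a a)%R.
Proof. by rewrite sqr_sqrtr ?dot_ge0. Qed.

Lemma gaussian_densityS s x (y : tup s) :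
  (gaussian_density (cons_pair (x, y)) = p x * gaussian_density y)%R.
Proof.
rewrite normal_pdf01E /gaussian_density !sqr_enorm mulrACA.
have pi2 : (2 * pi != 0 :> R)%R by rewrite mulf_neq0// gt_eqF// pi_gt0.
rewrite -powRD; last by rewrite pi2 implybT.
rewrite -expRD; congr (_ `^ _ * expR _)%R.
  by rewrite -natr1; field.
rewrite /dot big_ord_recl !mxE tnth_cons_pair0.
under eq_bigr do rewrite !mxE tnth_cons_pairS.
under [in RHS]eq_bigr do rewrite !mxE.
set S := (\sum_i _)%R; by field.
Qed.

Let mcons s : measurable_fun [set: _] (@cons_pair R s) := @measurable_cons_pair R s.

Lemma ge0_integral_lebesgue_tupleS s (f : tup s.+1 -> \bar R) :
  measurable_fun [set: tup s.+1] f -> (forall x, 0 <= f x) ->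
  \int[@lebesgue_tuple R s.+1]_x f x =
  \int[mu]_x \int[@lebesgue_tuple R s]_y f (cons_pair (x, y)).
Proof.
move=> mf f0.
rewrite ge0_integral_pushforward//=.
rewrite (@fubini_tonelli1 _ _ (measurableTypeR R) (tup s) R mu (lebesgue_tuple s))//.
- exact: (measurableT_comp mf (@mcons s)).
- exact: mcons.
Qed.

Lemma ge0_integral_gaussian s (f : tup s -> \bar R) :
  measurable_fun [set: tup s] f -> (forall x, 0 <= f x) ->
  \int[G s]_x f x =
  \int[@lebesgue_tuple R s]_x (f x * (gaussian_density x)%:E).
Proof.
move=> mf f0.
apply: (@ge0_integral_density _ (tup s) R (lebesgue_tuple s) (G s)) => //.
- exact: measurable_gaussian_density.
- exact: gaussian_density_ge0.
Qed.

Lemma ge0_integral_gaussian0 (f : tup 0 -> \bar R) :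
  measurable_fun [set: tup 0] f -> (forall x, 0 <= f x) ->
  \int[G 0]_x f x = f [tuple].
Proof.
move=> mf f0; rewrite ge0_integral_gaussian//=.
rewrite integral_dirac//=; last first.
  apply: emeasurable_funM => //; apply/measurable_EFinP.
  exact: measurable_gaussian_density.
rewrite diracT mul1e /gaussian_density mul0r oppr0 powRr0 mul1r.
by rewrite sqr_enorm /dot big_ord0 mul0r oppr0 expR0 mule1.
Qed.

(** Both the Lebesgue measure on tuples and the density factor through the first coordinate.
    Inductions on [s] go through this identity instead of the density. *)
Lemma ge0_integral_gaussianS s (f : tup s.+1 -> \bar R) :
  measurable_fun [set: tup s.+1] f -> (forall x, 0 <= f x) ->
  \int[G s.+1]_x f x = \int[N]_x \int[G s]_y f (cons_pair (x, y)).
Proof.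
move=> mf f0.
have mfc x : measurable_fun [set: tup s] (fun y => f (cons_pair (x, y))).
  apply: (measurableT_comp mf); apply: (measurableT_comp (@mcons s)).
  exact: measurable_pair1.
have md r : measurable_fun [set: tup r] (fun x => (gaussian_density x)%:E).
  by apply/measurable_EFinP; exact: measurable_gaussian_density.
have d0 r (x : tup r) : 0 <= (gaussian_density x)%:E.
  by rewrite lee_fin gaussian_density_ge0.
have p0 x : 0 <= (p x)%:E by rewrite lee_fin normal_pdf_ge0.
rewrite ge0_integral_gaussian// ge0_integral_lebesgue_tupleS; last 2 first.
- by apply: emeasurable_funM; [exact: mf|exact: md].
- by move=> x; rewrite mule_ge0.
rewrite ge0_integral_normal//; last 2 first.
- rewrite (_ : (fun x => _) = fubini_F (lebesgue_tuple s)
      (fun z => f (cons_pair z) * (gaussian_density z.2)%:E)).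
    apply: measurable_fun_fubini_tonelli_F => //=.
      apply: emeasurable_funM; first exact: (measurableT_comp mf (@mcons s)).
      exact: (measurableT_comp (md s)).
    by move=> z; rewrite mule_ge0.
  by apply/funext => x; rewrite ge0_integral_gaussian.
- by move=> x; exact: integral_ge0.
apply: eq_integral => x _; rewrite ge0_integral_gaussian//.
rewrite -ge0_integralZr//; last 2 first.
- by apply: emeasurable_funM; [exact: mfc|exact: md].
- by move=> y _; rewrite mule_ge0.
apply: eq_integral => y _.
by rewrite gaussian_densityS EFinM muleCA [RHS]muleC.
Qed.

Lemma gaussian_measureT s : G s [set: tup s] = 1.
Proof.
rewrite -[LHS]mul1e -integral_cst//.
elim: s => [|s ih]; first by rewrite ge0_integral_gaussian0.
rewrite ge0_integral_gaussianS//.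
under eq_integral do rewrite ih.
by rewrite integral_cst// mul1e; exact: probability_setT.
Qed.

HB.instance Definition _ s :=
  @Measure_isProbability.Build _ _ R (@gaussian_measure R s) (gaussian_measureT s).

End gaussian_product.

(** * Linear images of Gaussian vectors *)

Section gaussian_invariance.
Local Open Scope ereal_scope.
Context {R : realType}.
Notation N := (@normal_prob R 0 1).
Notation tup s := (s.-tuple (measurableTypeR R)).
Notation G s := (@gaussian_measure R s).

Lemma measurable_dot s (a : 'cV[R]_s) :
  measurable_fun [set: tup s] (fun x => dot a (vec_of x)).
Proof.
apply: measurable_sum => i; apply: measurable_funM => //.
by under eq_fun do rewrite mxE; exact: measurable_tnth.
Qed.

(** Induction on [s]: the tail contributes [enorm a'] times a standard normal, and [normal_rotation]
    merges it with the head. The offset [c] is there to absorb the head term when the induction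
    hypothesis is applied. *)
Lemma gaussian_marginal s (a : 'cV[R]_s) (c : R) (f : R -> \bar R) :
  measurable_fun [set: R] f -> (forall x, 0 <= f x) ->
  \int[G s]_x f (c + dot a (vec_of x))%R = \int[N]_x f (c + enorm a * x)%R.
Proof.
move=> mf f0.
have mfa s' (b : 'cV[R]_s') d :
    measurable_fun [set: tup s'] (fun x => f (d + dot b (vec_of x))%R).
  apply: (measurableT_comp mf); apply: measurable_funD => //.
  exact: measurable_dot.
elim: s a c => [|s ih] a c.
  rewrite ge0_integral_gaussian0//.
  rewrite -[LHS](integral_cst_probability N); apply: eq_integral => x _.
  by rewrite /enorm /dot !big_ord0 sqrtr0 mul0r.
rewrite ge0_integral_gaussianS//.
set a' : 'cV[R]_s := (\col_i a (lift ord0 i) 0)%R.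
have aE : (enorm a ^+ 2 = a 0 0 ^+ 2 + enorm a' ^+ 2)%R.
  rewrite !sqr_enorm /dot big_ord_recl expr2; congr (_ + _)%R.
  by apply: eq_bigr => i _; rewrite mxE.
transitivity (\int[N]_x \int[N]_z f (c + (a 0%R 0%R * x + enorm a' * z))%R).
  apply: eq_integral => x _; under eq_integral do rewrite dot_vec_of_cons addrA.
  by rewrite ih; apply: eq_integral => z _; rewrite addrA.
(* The rotation coefficients are quotients by [enorm a]; if this is 0, head and tail coefficients
   both vanish. *)
have [a0|a0] := eqVneq (enorm a) 0%R.
  have /eqP := aE; rewrite a0 expr0n eq_sym paddr_eq0 ?sqr_ge0// !sqrf_eq0.
  move=> /andP[/eqP-> /eqP->]; rewrite -[RHS](integral_cst_probability N).
  by do 2 (apply: eq_integral => ? _); rewrite !mul0r addr0.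
pose g (t : R) := f (c + enorm a * t)%R.
have mg : measurable_fun [set: R] g.
  by apply: (measurableT_comp mf); apply: measurable_funD => //; exact: measurable_funM.
apply: (etrans _ (@normal_rotation _ (a 0 0 / enorm a)%R (enorm a' / enorm a)%R
    g _ mg (fun x => f0 _))).
  by do 2 (apply: eq_integral => ? _); rewrite /g; congr (f (c + _))%R; field.
by rewrite !expr_div_n -mulrDl -aE divff// sqrf_eq0.
Qed.

Definition lincomb s (a b : R) (x y : tup s) : tup s :=
  [tuple (a * tnth x i + b * tnth y i)%R | i < s].

Lemma lincomb_cons s (a b : R) (x y : measurableTypeR R) (X Y : tup s) :
  lincomb a b (cons_pair (x, X)) (cons_pair (y, Y)) =
  cons_pair ((a * x + b * y)%R, lincomb a b X Y).
Proof.
apply: eq_from_tnth => i; rewrite tnth_mktuple.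
have [j ->|->] := unliftP ord0 i; last by rewrite !tnth_cons_pair0.
by rewrite !tnth_cons_pairS tnth_mktuple.
Qed.

Lemma measurable_lincomb d (T : measurableType d) s (a b : R) (f g : T -> tup s) :
  measurable_fun [set: T] f -> measurable_fun [set: T] g ->
  measurable_fun [set: T] (fun t => lincomb a b (f t) (g t)).
Proof.
move=> mf mg; apply/measurable_fun_tnthP => i; rewrite /comp.
under eq_fun do rewrite tnth_mktuple.
apply: measurable_funD; apply: measurable_funM => //.
  exact: (measurableT_comp (measurable_tnth i) mf).
exact: (measurableT_comp (measurable_tnth i) mg).
Qed.

Lemma vec_of_lincomb s (a b : R) (x y : tup s) (v : 'cV[R]_s) :
  (dot v (vec_of (lincomb a b x y)) =
   a * dot v (vec_of x) + b * dot v (vec_of y))%R.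
Proof.
rewrite /dot !mulr_sumr -big_split/=; apply: eq_bigr => i _.
by rewrite !mxE tnth_mktuple; ring.
Qed.

(** Independent Gaussian vectors X and Y are combined coordinate by coordinate: [normal_rotation]
    treats the heads, the induction hypothesis the tails. *)
Lemma ge0_gaussian_rotation s (a b : R) (f : tup s -> \bar R) :
  (a ^+ 2 + b ^+ 2 = 1)%R ->
  measurable_fun [set: tup s] f -> (forall x, 0 <= f x) ->
  \int[G s]_x \int[G s]_y f (lincomb a b x y) = \int[G s]_x f x.
Proof.
move=> ab; elim: s f => [|s ih] f mf f0.
  apply: eq_integral => x _; rewrite -[RHS](integral_cst_probability (G 0)).
  by apply: eq_integral => y _; rewrite [lincomb _ _ _ _]tuple0 [x]tuple0.
pose H (t : R) := \int[G s]_Z f (cons_pair (t, Z)).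
have mfc t : measurable_fun [set: tup s] (fun Z => f (cons_pair (t, Z))).
  apply: (measurableT_comp mf); apply: (measurableT_comp (@measurable_cons_pair R s)).
  exact: measurable_pair1.
have mH : measurable_fun [set: R] H.
  apply: (@measurable_fun_fubini_tonelli_F _ _ (measurableTypeR R) (tup s) R (G s)
    (fun z => f (cons_pair z))) => //.
  exact: (measurableT_comp mf (@measurable_cons_pair R s)).
have H0 t : 0 <= H t by exact: integral_ge0.
rewrite [RHS]ge0_integral_gaussianS// -/H -(@normal_rotation _ a b)//.
have mL : measurable_fun [set: tup s.+1 * tup s.+1]
    (fun Z => f (lincomb a b Z.1 Z.2)).
  by apply: (measurableT_comp mf); exact: measurable_lincomb.
rewrite ge0_integral_gaussianS//; last 2 first.
- exact: (@measurable_fun_fubini_tonelli_F _ _ (tup s.+1) (tup s.+1) R (G s.+1) _ mL).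
- by move=> x; exact: integral_ge0.
apply: eq_integral => x _.
transitivity (\int[G s]_X \int[N]_y \int[G s]_Y
    f (cons_pair ((a * x + b * y)%R, lincomb a b X Y))).
  apply: eq_integral => X _.
  rewrite (@ge0_integral_gaussianS _ s
    (fun Y => f (lincomb a b (cons_pair (x, X)) Y)))//.
    by do 2 (apply: eq_integral => ? _); rewrite lincomb_cons.
  by apply: (measurableT_comp mf); exact: measurable_lincomb.
(* Peeling both vectors integrates in the order x, X, y, Y. [K] is the integrand for which Tonelli
   exchanges X and y, so that the two tails become adjacent. *)
pose K (z : tup s * measurableTypeR R) := \int[G s]_Y
  f (cons_pair ((a * x + b * z.2)%R, lincomb a b z.1 Y)).
have mK : measurable_fun [set: tup s * measurableTypeR R] K.
  apply: (@measurable_fun_fubini_tonelli_F _ _ (tup s * measurableTypeR R)%type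
    (tup s) R (G s)
    (fun w => f (cons_pair ((a * x + b * w.1.2)%R, lincomb a b w.1.1 w.2)))) => //.
  apply: (measurableT_comp mf); apply: (measurableT_comp (@measurable_cons_pair R s)).
  apply: measurable_fun_pair.
    apply: measurable_funD => //; apply: measurable_funM => //.
    exact: (measurableT_comp measurable_snd measurable_fst).
  apply: measurable_lincomb; last exact: measurable_snd.
  exact: (measurableT_comp measurable_fst measurable_fst).
rewrite (@fubini_tonelli _ _ (tup s) (measurableTypeR R) R (G s) N K)//.
  apply: eq_integral => y _; rewrite /K/=.
  by rewrite (ih (fun Z => f (cons_pair (_, Z)))).
by move=> z; exact: integral_ge0.
Qed.

End gaussian_invariance.

(** * Expectations of bounded real functions *)

Section bounded_expectation.
Context {d} {T : measurableType d} {R : realType} (P : probability T R).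

Lemma bounded_integrable (f : T -> R) (C : R) : measurable_fun [set: T] f ->
  (forall x, `|f x| <= C) -> P.-integrable [set: T] (EFin \o f).
Proof.
move=> mf fC; apply: measurable_bounded_integrable => //.
  by apply: (@le_lt_trans _ _ 1%E); [exact: probability_le1|exact: ltry].
exists C; split; first exact: num_real.
by move=> M CM x _; exact: le_trans (fC x) (ltW CM).
Qed.

Lemma Rintegral_cst_probability (c : R) : \int[P]_x c = c.
Proof. by rewrite /Rintegral integral_cst_probability. Qed.

Lemma Rintegral_bounded (f : T -> R) (C : R) : measurable_fun [set: T] f ->
  (forall x, `|f x| <= C) -> `|\int[P]_x f x| <= C.
Proof.
move=> mf fC; have fi := bounded_integrable mf fC.
apply: (le_trans (le_normr_Rintegral _ fi)) => //.
rewrite -[leRHS]Rintegral_cst_probability; apply: le_Rintegral => //.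
- apply: (@bounded_integrable _ C); first exact: measurableT_comp.
  by move=> x; rewrite normr_id.
- exact: finite_measure_integrable_cst.
Qed.

(** Bridge from the nonnegative extended-real identities to bounded real functions: adding the bound
    [C] makes the integrand nonnegative, and on a probability space it adds exactly [C] to the
    integral. *)
Lemma EFin_Rintegral_shift (f : T -> R) (C : R) : measurable_fun [set: T] f ->
  (forall x, `|f x| <= C) ->
  (\int[P]_x f x + C)%:E = (\int[P]_x (f x + C)%:E)%E.
Proof.
move=> mf fC; have fi := bounded_integrable mf fC.
have Ci : P.-integrable setT (EFin \o cst C).
  exact: finite_measure_integrable_cst.
rewrite -{1}(Rintegral_cst_probability C) -RintegralD//.
by rewrite /Rintegral fineK//; apply: integrable_fin_num => //; exact: (integrableD measurableT fi Ci).
Qed.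

Lemma cvg_Rintegral_bounded (f_ : nat -> T -> R) (f : T -> R) (C : R) :
  (forall n, measurable_fun [set: T] (f_ n)) ->
  (forall n x, `|f_ n x| <= C) ->
  (forall x, f_ n x @[n --> \oo] --> f x) ->
  \int[P]_x f_ n x @[n --> \oo] --> \int[P]_x f x.
Proof.
move=> mf fC fcvg.
have mf' : measurable_fun [set: T] f by exact: measurable_fun_cvg.
have m1 n : measurable_fun [set: T] (EFin \o f_ n) by exact/measurable_EFinP.
have m2 : measurable_fun [set: T] (EFin \o f) by exact/measurable_EFinP.
have c1 : {ae P, forall x, [set: T] x -> (EFin \o f_ n) x @[n --> \oo] --> (EFin \o f) x}.
  by apply: aeW => x _; apply: cvg_EFin; [exact: nearW|exact: fcvg].
have i1 : P.-integrable [set: T] (cst C%:E).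
  exact: (finite_measure_integrable_cst P C measurableT).
have b1 : {ae P, forall x, forall n, [set: T] x -> (`|(EFin \o f_ n) x| <= cst C%:E x)%E}.
  by apply: aeW => x n _; rewrite /= lee_fin.
have [fi _ cv] := dominated_convergence measurableT m1 m2 c1 i1 b1.
apply: fine_cvg; rewrite fineK; first exact: cv.
exact: integrable_fin_num.
Qed.

End bounded_expectation.

Lemma measurable_Rintegral d1 d2 (T1 : measurableType d1)
    (T2 : measurableType d2) (R : realType) (P : probability T2 R)
    (f : T1 * T2 -> R) (C : R) : measurable_fun [set: T1 * T2] f ->
  (forall x, `|f x| <= C) ->
  measurable_fun [set: T1] (fun x => \int[P]_y f (x, y)).
Proof.
move=> mf fC.
rewrite (_ : (fun x => _) = (fun x => fine (fubini_F P (fun z => (f z + C)%:E) x) - C)).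
  apply: measurable_funB => //; apply: measurableT_comp => //.
  apply: measurable_fun_fubini_tonelli_F => //.
    by apply/measurable_EFinP; exact: measurable_funD.
  by move=> x; rewrite lee_fin -lerBlDr sub0r; have /ler_normlP[] := fC x; rewrite lerNl.
apply/funext => x; rewrite /fubini_F -EFin_Rintegral_shift ?addrK//.
exact: (measurableT_comp mf (measurable_pair1 x)).
Qed.

Section gaussian_expectation.
Context {R : realType}.
Notation N := (@normal_prob R 0 1).
Notation tup s := (s.-tuple (measurableTypeR R)).
Notation G s := (@gaussian_measure R s).

Let shift_ge0 (C x : R) : `|x| <= C -> (0 <= (x + C)%:E)%E.
Proof. by move=> /ler_normlP[xC _]; rewrite lee_fin -lerBlDr sub0r lerNl. Qed.

Lemma gaussian_Rintegral_rotation s (a b : R) (f : tup s -> R) (C : R) :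
  a ^+ 2 + b ^+ 2 = 1 -> measurable_fun [set: tup s] f ->
  (forall x, `|f x| <= C) ->
  \int[G s]_x f x = \int[G s]_x \int[G s]_y f (lincomb a b x y).
Proof.
move=> ab mf fC.
have mL : measurable_fun [set: tup s * tup s] (fun z => f (lincomb a b z.1 z.2)).
  by apply: (measurableT_comp mf); exact: measurable_lincomb.
have mL1 x : measurable_fun [set: tup s] (fun y => f (lincomb a b x y)).
  by apply: (measurableT_comp mf); exact: measurable_lincomb.
apply/(addIr C)/EFin_inj; rewrite !EFin_Rintegral_shift//.
- rewrite -(ge0_gaussian_rotation ab)//.
  + apply: eq_integral => x _.
    by rewrite (@EFin_Rintegral_shift _ _ _ _ (fun y => f (lincomb a b x y))).
  + by apply/measurable_EFinP; exact: measurable_funD.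
  + by move=> x; exact: shift_ge0.
- exact: (@measurable_Rintegral _ _ (tup s) (tup s) R (G s) _ C mL).
- by move=> x; exact: Rintegral_bounded.
Qed.

Lemma gaussian_Rintegral_marginal s (a : 'cV[R]_s) (f : R -> R) (C : R) :
  measurable_fun [set: R] f -> (forall x, `|f x| <= C) ->
  \int[G s]_x f (dot a (vec_of x)) = \int[N]_x f (enorm a * x).
Proof.
move=> mf fC.
apply/(addIr C)/EFin_inj; rewrite !EFin_Rintegral_shift//.
- under eq_integral do rewrite -[dot a _]add0r.
  rewrite (@gaussian_marginal _ _ a 0 (fun x => (f x + C)%:E)).
  + by apply: eq_integral => x _; rewrite add0r.
  + by apply/measurable_EFinP; exact: measurable_funD.
  + by move=> x; exact: shift_ge0.
- apply: (measurableT_comp mf); exact: measurable_funM.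
- by apply: (measurableT_comp mf); exact: measurable_dot.
Qed.

Lemma normal_Rintegral_rotation (a b : R) (f : R -> R) (C : R) :
  a ^+ 2 + b ^+ 2 = 1 -> measurable_fun [set: R] f ->
  (forall x, `|f x| <= C) ->
  \int[N]_x f x = \int[N]_x \int[N]_y f (a * x + b * y).
Proof.
move=> ab mf fC.
have mab : measurable_fun [set: measurableTypeR R * measurableTypeR R]
    (fun z => a * z.1 + b * z.2 : R).
  by apply: measurable_funD; apply: measurable_funM => //.
have mL := measurableT_comp mf mab.
have mL1 x : measurable_fun [set: R] (fun y => f (a * x + b * y)).
  by apply: (measurableT_comp mf); apply: measurable_funD => //; exact: measurable_funM.
apply/(addIr C)/EFin_inj; rewrite !EFin_Rintegral_shift//.
- rewrite -(@normal_rotation _ a b)//.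
  + apply: eq_integral => x _.
    apply/esym; exact: (@EFin_Rintegral_shift _ (measurableTypeR R) R N
      (fun y => f (a * x + b * y)) C (mL1 x) (fun y => fC _)).
  + by apply/measurable_EFinP; exact: measurable_funD.
  + by move=> x; exact: shift_ge0.
- exact: (@measurable_Rintegral _ _ (measurableTypeR R) (measurableTypeR R) R N _ C mL (fun z => fC _)).
- move=> x; exact: (@Rintegral_bounded _ (measurableTypeR R) R N _ C (mL1 x) (fun y => fC _)).
Qed.

End gaussian_expectation.

(** * Moments of Gaussian measures up to order three *)

Section gaussian_moments.
Context {R : realType}.
Notation mu := (@lebesgue_measure R).
Notation N := (@normal_prob R 0 1).
Notation tup s := (s.-tuple (measurableTypeR R)).
Notation G s := (@gaussian_measure R s).

(** Keeping 1 + u^2/2 of the exponential series at u = x^2/4 gives 1 + x^4/32; the factor 33 exceeds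
    32, so the quartic coefficient is at least 1 and dominates the cube. The exponent x^2/4 is half
    of what the normal density can absorb. *)
Let cube_le_expR (x : R) : `|x| ^+ 3 <= 33 * expR (x ^+ 2 / 4).
Proof.
have u0 : 0 <= x ^+ 2 / 4 by rewrite divr_ge0// sqr_ge0.
apply: (@le_trans _ _ (33 * (1 + (x ^+ 2 / 4) ^+ 2 / 2))); last first.
  by rewrite ler_wpM2l// (expR_ge1Dxn 1).
rewrite -[in leRHS](real_normK (num_real x)).
have := normr_ge0 x; move: `|x| => t t0.
have : 0 <= (t ^+ 2 - t / 2) ^+ 2 by exact: sqr_ge0.
have : 0 <= (t - 1) ^+ 2 by exact: sqr_ge0.
have := sqr_ge0 (t ^+ 2).
nra.
Qed.

Lemma normal_integrable_cube : N.-integrable [set: R] (fun x => (`|x| ^+ 3)%:E).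
Proof.
have mcube : measurable_fun [set: R] (fun x : R => `|x| ^+ 3).
  by apply: measurable_funX; exact: normr_measurable.
have mh : measurable_fun [set: R] (fun x : R => 33 * expR (x ^+ 2 / 4)).
  apply: measurable_funM => //; apply: measurableT_comp => //.
  by apply: measurable_funM => //; exact: measurable_funX.
apply: (@le_integrable _ _ _ N _ measurableT _ (fun x => (33 * expR (x ^+ 2 / 4))%:E)).
- exact/measurable_EFinP.
- move=> x _; rewrite /= lee_fin ger0_norm ?exprn_ge0//.
  by rewrite [leRHS]ger0_norm ?mulr_ge0 ?expR_ge0.
have e0 x : (0 <= (33 * expR (x ^+ 2 / 4) : R)%:E)%E.
  by rewrite lee_fin mulr_ge0// expR_ge0.
apply/integrableP; split; first exact/measurable_EFinP.
under eq_integral do rewrite gee0_abs//.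
rewrite ge0_integral_normal//; last exact/measurable_EFinP.
have s2 : Num.sqrt 2 != 0 :> R by rewrite gt_eqF// sqrtr_gt0.
(* exp(x^2/4) times the standard normal density is proportional to the normal density of variance 2,
   whose integral is 1; [c] is the ratio of the peaks times 33. *)
pose c : R := 33 * normal_peak 1 / normal_peak (Num.sqrt 2).
rewrite (_ : (fun x => _) = (fun x => (c * normal_pdf 0 (Num.sqrt 2) x)%:E)).
  rewrite (_ : (fun x => _) = (fun x => (c%:E * (normal_pdf 0 (Num.sqrt 2) x)%:E)%E))//.
  rewrite integralZl//=; last exact: integrable_normal_pdf.
  by rewrite integral_normal_pdf mule1 ltry.
apply/funext => x; rewrite -EFinM; congr EFin.
rewrite !normal_pdfE ?oner_neq0// /normal_fun !subr0 expr1n sqr_sqrtr//.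
have p0 : normal_peak (Num.sqrt 2) != 0 :> R by rewrite gt_eqF// normal_peak_gt0.
rewrite mulrACA mulrA [RHS]mulrA divfK// -mulrA -expRD; congr (_ * expR _).
by field.
Qed.

Let integrable_le_cube (f : R -> R) : measurable_fun [set: R] f ->
  (forall x, `|f x| <= 1 + `|x| ^+ 3) -> N.-integrable [set: R] (EFin \o f).
Proof.
move=> mf fle.
have mcube : measurable_fun [set: R] (fun x : R => `|x| ^+ 3).
  by apply: measurable_funX; exact: normr_measurable.
apply: (@le_integrable _ _ _ N _ measurableT _ ((EFin \o cst 1%R) \+ (fun x => (`|x| ^+ 3)%:E))%E).
- exact/measurable_EFinP.
- move=> x _; rewrite /= lee_fin [leRHS]ger0_norm ?addr_ge0 ?exprn_ge0//.
- apply: integrableD => //; last exact: normal_integrable_cube.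
  exact: finite_measure_integrable_cst.
Qed.

(** Lower powers are dominated through (t + 1)(t - 1)^2 >= 0, that is t + t^2 <= 1 + t^3 for t >=
    0. *)
Lemma normal_integrable_id : N.-integrable [set: R] (fun x => x%:E).
Proof.
apply: (@integrable_le_cube id) => // x.
have := normr_ge0 x; rewrite /=; move: `|x| => t t0.
have : 0 <= (t + 1) * (t - 1) ^+ 2 by rewrite mulr_ge0 ?sqr_ge0 ?addr_ge0.
rewrite (_ : (t + 1) * (t - 1) ^+ 2 = t ^+ 3 - t ^+ 2 - t + 1); last by ring.
have := sqr_ge0 t; lra.
Qed.

Lemma normal_integrable_sqr : N.-integrable [set: R] (fun x => (x ^+ 2)%:E).
Proof.
apply: (@integrable_le_cube (fun x => x ^+ 2)); first exact: measurable_funX.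
move=> x; rewrite normrX.
have := normr_ge0 x; move: `|x| => t t0.
have : 0 <= (t + 1) * (t - 1) ^+ 2 by rewrite mulr_ge0 ?sqr_ge0 ?addr_ge0.
by rewrite (_ : (t + 1) * (t - 1) ^+ 2 = t ^+ 3 - t ^+ 2 - t + 1); [lra|ring].
Qed.

(** The law is symmetric, by [normal_rotation] with coefficients (-1, 0), and x = f(x) - f(-x) for
    [f] the positive part. The split lets the nonnegative statement of symmetry apply. *)
Lemma normal_mean0 : \int[N]_x x = 0 :> R.
Proof.
have sym (f : R -> \bar R) : measurable_fun [set: R] f ->
    (forall x, (0 <= f x)%E) -> (\int[N]_x f (- x)%R = \int[N]_x f x)%E.
  move=> mf f0; rewrite -[RHS](@normal_rotation _ (-1) 0)//.
    apply: eq_integral => x _; rewrite -[LHS](integral_cst_probability N).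
    by apply: eq_integral => y _; rewrite mulN1r mul0r addr0.
  by rewrite sqrrN expr1n expr0n addr0.
pose f (x : R) := Num.max x 0.
have mf : measurable_fun [set: R] f by exact: measurable_maxr.
have f0 x : 0 <= f x by rewrite le_max lexx orbT.
have e : \int[N]_x f (- x) = \int[N]_x f x.
  congr fine; apply: (sym (EFin \o f)); first exact/measurable_EFinP.
  by move=> x; rewrite lee_fin.
have cube (t : R) : 0 <= t -> t <= 1 + t ^+ 3.
  move=> t0; have : 0 <= (t + 1) * (t - 1) ^+ 2 by rewrite mulr_ge0 ?sqr_ge0 ?addr_ge0.
  rewrite (_ : (t + 1) * (t - 1) ^+ 2 = t ^+ 3 - t ^+ 2 - t + 1); last by ring.
  by have := sqr_ge0 t; lra.
have fle x : `|f x| <= 1 + `|x| ^+ 3.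
  rewrite ger0_norm//; apply: (le_trans _ (cube _ (normr_ge0 x))).
  by rewrite ge_max ler_norm normr_ge0.
have fi := integrable_le_cube mf fle.
have fNi : N.-integrable [set: R] (EFin \o (fun x => f (- x))).
  apply: integrable_le_cube; first exact: measurableT_comp.
  by move=> x; rewrite -(normrN x).
transitivity (\int[N]_x (f x - f (- x))); last by rewrite RintegralB// e subrr.
apply: eq_Rintegral => x _; rewrite /f; case: (leP x 0) => x0.
  by rewrite max_l ?oppr_ge0// sub0r opprK.
by rewrite max_r ?oppr_le0 ?ltW// subr0.
Qed.

Definition normal_variance : R := \int[N]_x (x ^+ 2).
Definition normal_cube : R := \int[N]_x (`|x| ^+ 3).

(** If the integral of x^2 vanished, the whole mass would sit at 0, but a law with a density does
    not charge points. *)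
Lemma normal_variance_gt0 : 0 < normal_variance.
Proof.
have v0 : 0 <= normal_variance by apply: Rintegral_ge0 => x _; exact: sqr_ge0.
rewrite lt_neqAle v0 andbT eq_sym; apply/eqP => v_eq0.
have i2 : (\int[N]_x `|(x ^+ 2)%:E| = 0)%E.
  transitivity (\int[N]_x (x ^+ 2)%:E)%E.
    by apply: eq_integral => x _; rewrite gee0_abs// lee_fin sqr_ge0.
  rewrite -[LHS]fineK; first exact: (congr1 EFin v_eq0).
  by apply: integrable_fin_num => //; exact: normal_integrable_sqr.
have m2 : measurable_fun [set: R] (fun x : R => (x ^+ 2)%:E).
  by apply/measurable_EFinP; exact: measurable_funX.
have /(ae_eq_integral_abs N measurableT m2) [A [mA A0 sA]] := i2.
have : (N [set: R] <= N A + N [set 0%R])%E.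
  have m0 : measurable [set 0%R : measurableTypeR R] by exact: measurable_set1.
  apply: (le_trans _ (measureU2 N mA m0)).
  apply: le_measure; rewrite ?inE//; first exact: measurableU.
  move=> x _ /=; have [->|x0] := eqVneq x 0; [by right|left].
  apply: sA => /= /(_ I) [] /eqP; rewrite sqrf_eq0; exact/negP.
have N0 : N [set 0] = 0%E by exact: integral_set1.
have N1 : N [set: R] = 1%E by exact: (probability_setT N).
by rewrite A0 N0 N1 adde0 lee_fin ler10.
Qed.

Lemma gaussian_integrable_cube s (a : 'cV[R]_s) :
  (G s).-integrable [set: tup s] (fun x => (`|dot a (vec_of x)| ^+ 3)%:E).
Proof.
have mcube : measurable_fun [set: R] (fun x : R => `|x| ^+ 3).
  by apply: measurable_funX; exact: normr_measurable.
apply/integrableP; split.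
  by apply/measurable_EFinP; apply: (measurableT_comp mcube); exact: measurable_dot.
under eq_integral do rewrite gee0_abs ?lee_fin ?exprn_ge0// -[dot _ _]add0r.
rewrite (@gaussian_marginal _ _ a 0 (fun x => (`|x| ^+ 3)%:E)); last 2 first.
- exact/measurable_EFinP.
- by move=> x; rewrite lee_fin exprn_ge0.
have i : N.-integrable [set: R] (fun x => (enorm a ^+ 3)%:E * (`|x| ^+ 3)%:E)%E.
  by apply: integrableZl => //; exact: normal_integrable_cube.
apply: le_lt_trans (integrable_lty measurableT i).
rewrite le_eqVlt; apply/orP; left; apply/eqP/eq_integral => x _.
by rewrite add0r normrM exprMn EFinM (ger0_norm (sqrtr_ge0 _)).
Qed.

Lemma gaussian_Rintegral_cube s (a : 'cV[R]_s) :
  \int[G s]_x `|dot a (vec_of x)| ^+ 3 = enorm a ^+ 3 * normal_cube.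
Proof.
have mcube : measurable_fun [set: R] (fun x : R => `|x| ^+ 3).
  by apply: measurable_funX; exact: normr_measurable.
rewrite /normal_cube -RintegralZl//; last exact: normal_integrable_cube.
congr fine; under eq_integral do rewrite -[dot _ _]add0r.
rewrite (@gaussian_marginal _ _ a 0 (fun x => (`|x| ^+ 3)%:E)); last 2 first.
- exact/measurable_EFinP.
- by move=> x; rewrite lee_fin exprn_ge0.
by apply: eq_integral => x _; rewrite add0r normrM exprMn (ger0_norm (sqrtr_ge0 _)).
Qed.

Lemma gaussian_Rintegral_sqr s (a : 'cV[R]_s) :
  \int[G s]_x (dot a (vec_of x)) ^+ 2 = dot a a * normal_variance.
Proof.
have msqr : measurable_fun [set: R] (fun x : R => x ^+ 2) by exact: measurable_funX.
rewrite /normal_variance -RintegralZl//; last exact: normal_integrable_sqr.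
congr fine; under eq_integral do rewrite -[dot _ _]add0r.
rewrite (@gaussian_marginal _ _ a 0 (fun x => (x ^+ 2)%:E)); last 2 first.
- exact/measurable_EFinP.
- by move=> x; rewrite lee_fin sqr_ge0.
by apply: eq_integral => x _; rewrite add0r exprMn sqr_enorm.
Qed.

(** Uses 2 t u <= t^2 + u^2 and v^2 <= 1 + v^3 to fall back on the integrable cubes. *)
Lemma gaussian_integrable_prod s (a b : 'cV[R]_s) :
  (G s).-integrable [set: tup s]
    (fun x => (dot a (vec_of x) * dot b (vec_of x))%:E).
Proof.
apply: (@le_integrable _ _ _ (G s) _ measurableT _ (fun x => (1 +
  (`|dot a (vec_of x)| ^+ 3 + `|dot b (vec_of x)| ^+ 3))%:E)).
- by apply/measurable_EFinP; apply: measurable_funM; exact: measurable_dot.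
- move=> x _; rewrite /= lee_fin normrM.
  rewrite [leRHS]ger0_norm ?addr_ge0 ?exprn_ge0//.
  move: (normr_ge0 (dot a (vec_of x))) (normr_ge0 (dot b (vec_of x))).
  move: `|_| `|_| => t u t0 u0.
  have cube (v : R) : 0 <= v -> v ^+ 2 <= 1 + v ^+ 3.
    move=> v0; have : 0 <= (v + 1) * (v - 1) ^+ 2 by rewrite mulr_ge0 ?sqr_ge0 ?addr_ge0.
    by rewrite (_ : (v + 1) * (v - 1) ^+ 2 = v ^+ 3 - v ^+ 2 - v + 1); [lra|ring].
  have := cube _ t0; have := cube _ u0; have := exprn_ge0 3 t0.
  have := exprn_ge0 3 u0; have := sqr_ge0 (t - u).
  rewrite (_ : (t - u) ^+ 2 = t ^+ 2 + u ^+ 2 - 2 * (t * u)); last by ring.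
  lra.
- apply: (@integrableD _ _ _ _ _ measurableT (cst 1%E) (fun x =>
    (`|dot a (vec_of x)| ^+ 3 + `|dot b (vec_of x)| ^+ 3)%:E)).
    exact: (finite_measure_integrable_cst (G s) 1 measurableT).
  by apply: (@integrableD _ _ _ _ _ measurableT (fun x => (`|dot a (vec_of x)| ^+ 3)%:E)
    (fun x => (`|dot b (vec_of x)| ^+ 3)%:E)); exact: gaussian_integrable_cube.
Qed.

(** Polarization of [gaussian_Rintegral_sqr], applied to a + b and a - b. *)
Lemma gaussian_covariance s (a b : 'cV[R]_s) :
  \int[G s]_x (dot a (vec_of x) * dot b (vec_of x)) =
  dot a b * normal_variance.
Proof.
have dotD x : dot (a + b) (vec_of x) = dot a (vec_of x) + dot b (vec_of x).
  by rewrite /dot -big_split/=; apply: eq_bigr => i _; rewrite !mxE mulrDl.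
have dotB x : dot (a - b) (vec_of x) = dot a (vec_of x) - dot b (vec_of x).
  by rewrite /dot -sumrB; apply: eq_bigr => i _; rewrite !mxE mulrBl.
have e : dot a b = 4^-1 * (dot (a + b) (a + b) - dot (a - b) (a - b)).
  rewrite /dot -sumrB mulr_sumr; apply: eq_bigr => i _.
  by rewrite !mxE; field.
rewrite e -mulrA mulrBl -!gaussian_Rintegral_sqr -RintegralB//; last 2 first.
- by have := gaussian_integrable_prod (a + b) (a + b); under eq_fun do rewrite -expr2.
- by have := gaussian_integrable_prod (a - b) (a - b); under eq_fun do rewrite -expr2.
rewrite -RintegralZl//.
  by apply: eq_Rintegral => x _; rewrite dotD dotB; field.
apply: (@integrableB _ _ _ _ _ measurableT
  (fun x => (dot (a + b) (vec_of x) ^+ 2)%:E) (fun x => (dot (a - b) (vec_of x) ^+ 2)%:E)).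
  by have := gaussian_integrable_prod (a + b) (a + b); under eq_fun do rewrite -expr2.
by have := gaussian_integrable_prod (a - b) (a - b); under eq_fun do rewrite -expr2.
Qed.

End gaussian_moments.

(** * Continuous functions are measurable for the product sigma-algebra *)

Section continuous_tuple.
Context {R : realType}.
Notation tup s := (s.-tuple (measurableTypeR R)).

Definition row_of s (x : tup s) : 'rV[R]_s := \row_i tnth x i.

(* A continuous function is the pointwise limit of its compositions with the
   rounding [disc m], which takes countably many values. *)
Let fl m (x : R) : int := Num.floor (x * m.+1%:R).
Let disc m (x : R) : R := (fl m x)%:~R / m.+1%:R.

Let discP m (x : R) : `|x - disc m x| <= m.+1%:R^-1.
Proof.
have /andP[l u] := floor_itv (x * m.+1%:R).
have m0 : 0 < m.+1%:R :> R by rewrite ltr0n.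
rewrite ger0_norm; last by rewrite subr_ge0 ler_pdivrMr.
rewrite -[X in _ <= X]mul1r -(@ler_pM2r _ m.+1%:R)// divfK ?gt_eqF//.
by rewrite mulrBl divfK ?gt_eqF// lerBlDl; move: u; rewrite intrD => /ltW.
Qed.

Lemma measurable_continuous_tuple s (f : 'rV[R]_s -> R) : continuous f ->
  measurable_fun [set: tup s] (f \o @row_of s).
Proof.
move=> cf.
pose D m (x : tup s) : 'rV[R]_s := \row_i disc m (tnth x i).
apply: (@measurable_fun_cvg _ _ _ _ (fun m => f \o D m)).
- move=> m _ Y mY; rewrite setTI.
  (* [H z] is the grid point of index [z], and [F z] the cell of points rounded to it, kept only if
     f sends that grid point into [Y]. The preimage of [Y] is the union of these countably many
     cells. *)
  pose H (z : {ffun 'I_s -> int}) : 'rV[R]_s := \row_i ((z i)%:~R / m.+1%:R).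
  pose F (z : {ffun 'I_s -> int}) := if f (H z) \in Y then
    \bigcap_i [set x : tup s | fl m (tnth x i) = z i] else set0.
  rewrite (_ : _ @^-1` _ = \bigcup_z F z).
    apply: countable_bigcupT_measurable; first exact: countableP.
    move=> z; rewrite /F; case: ifPn => // _.
    apply: fin_bigcap_measurable => // i _.
    have mfl : measurable_fun [set: R] (fun x => (fl m x)%:~R : R).
      apply: nondecreasing_measurable => // x y xy; rewrite ler_int le_floor//.
      by rewrite ler_wpM2r.
    have := measurableT_comp mfl (@measurable_tnth _ (measurableTypeR R) s i).
    move=> /(_ measurableT [set (z i)%:~R] (measurable_set1 _)).
    rewrite setTI; congr measurable; apply/seteqP; split => x /=.
      by move=> /(@intr_inj R).
    by move=> ->.
  apply/seteqP; split => [x /= Yx|x [z _]].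
    exists [ffun i => fl m (tnth x i)] => //; rewrite /F ifT.
      by move=> i _ /=; rewrite ffunE.
    rewrite inE; move: Yx; congr (Y (f _)); apply/rowP => i.
    by rewrite !mxE ffunE.
  rewrite /F; case: ifPn => // + xz; rewrite inE => Yz /=.
  move: Yz; congr (Y (f _)); apply/rowP => i; rewrite !mxE /disc.
  by have -> := xz i I.
- move=> x _; apply: (cvg_comp (D ^~ x) f); last exact: cf.
  apply/cvgrPdist_le => e e0; near=> m.
  rewrite /Num.norm/= mx_normrE; apply: bigmax_le => [|[i j] _]; first exact: ltW.
  rewrite ord1 !mxE/=; apply: le_trans (discP _ _) _.
  near: m; by apply: filterS (near_infty_natSinv_lt (PosNum e0)) => n /ltW.
Unshelve. all: by end_near. Qed.

End continuous_tuple.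

(** * Taylor expansion on compact boxes *)

Section line_derivative.
Context {R : realType} {n : nat}.
Implicit Types (f : 'rV[R]_n -> R) (u v w p q : 'rV[R]_n).

Lemma MVT_bound (g dg : R -> R) (e : R) :
  (forall r : R, 0 <= r <= 1 -> is_derive r 1 g (dg r)) ->
  (forall r : R, 0 <= r <= 1 -> `|dg r| <= e) ->
  forall s : R, 0 <= s <= 1 -> `|g s - g 0| <= e.
Proof.
move=> gd ge s /andP[s0 s1].
have r01 r : r \in `[0, s]%R -> 0 <= r <= 1.
  by rewrite in_itv/= => /andP[-> rs]; exact: le_trans rs s1.
have d0s x : x \in `]0, s[%R -> is_derive x 1 g (dg x).
  by move=> xs; apply: gd; apply: r01; exact: subset_itv_oo_cc.
have c0s : {within `[0, s], continuous g}.
  apply: derivable_within_continuous => x /r01 x01.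
  by have [] := gd x x01.
have [c cs ->] := MVT_segment s0 d0s c0s.
rewrite subr0 normrM (ger0_norm s0) -[leRHS]mulr1.
by apply: ler_pM => //; apply: ge; exact: r01.
Qed.

Lemma is_derive_mulr (c s : R) :
  is_derive s 1 (fun r : R => r * c) c.
Proof.
have := @is_deriveM _ _ id (cst c) s 1 1 0 _ _.
by rewrite scaler0 add0r => /(_ _ _); rewrite /GRing.scale/= mulr1; apply.
Qed.

Lemma is_derive_partial f w (c s : R) (k : 'I_n) :
  derivable f (w + (s * c) *: delta_mx 0 k) (delta_mx 0 k) ->
  is_derive s 1 (fun r : R => f (w + (r * c) *: delta_mx 0 k))
    (c * partial k f (w + (s * c) *: delta_mx 0 k)).
Proof.
move=> fd; set e := delta_mx 0 k.
have H : is_derive (s * c) 1 (fun r : R => f (w + r *: e))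
    (partial k f (w + (s * c) *: e)).
  have E : (fun h : R => h^-1 *: (f (w + (h%:A + s * c) *: e) - f (w + (s * c) *: e)))
      = (fun h : R => h^-1 *: (f (h *: e + (w + (s * c) *: e)) - f (w + (s * c) *: e))).
    apply/funext => h; congr (_ *: (f _ - _)).
    by rewrite [h%:A]mulr1 scalerDl addrCA.
  apply: DeriveDef.
    by move: fd; rewrite /derivable /= -/e -E.
  by rewrite /partial /derive /= -/e -E.
have Hs : is_derive s 1 (fun r : R => r * c) c.
  exact: is_derive_mulr.
have := @is_derive1_comp _ (fun r : R => f (w + r *: e)) (fun r : R => r * c) s _ _ H Hs.
by rewrite mulrC.
Qed.

End line_derivative.

Section chain_rule.
Context {R : realType} {n : nat}.
Implicit Types (f : 'rV[R]_n -> R) (u v w p q : 'rV[R]_n) (D : set 'rV[R]_n).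

(* The increment of [f] along [v] is telescoped into increments along the axes. *)
Let trunc k v : 'rV[R]_n := \row_j (if (j < k)%N then v 0 j else 0).

Let truncS v (k : 'I_n) : trunc k.+1 v = trunc k v + v 0 k *: delta_mx 0 k.
Proof.
apply/rowP => j; rewrite !mxE eqxx/= ltnS leq_eqVlt.
have [/val_inj ->|jk] := eqVneq (j : nat) k.
  by rewrite ltnn eqxx mulr1 add0r.
by rewrite (_ : (j == k) = false) ?mulr0 ?addr0//; apply/negbTE; apply: contra jk => /eqP->.
Qed.

(** Continuity of the partial derivatives is what makes them control arbitrary directions: on each
    axis increment the partial derivative stays close to its value at the base point. *)
Lemma is_derive_line D f p v (t : R) : open D ->
  (forall u, D u -> forall i, derivable f u (delta_mx 0 i)) ->
  (forall u, D u -> forall i, {for u, continuous (partial i f)}) ->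
  D (p + t *: v) ->
  is_derive t 1 (fun r : R => f (p + r *: v))
    (\sum_j v 0 j * partial j f (p + t *: v)).
Proof.
move=> oD fd fc; set u := p + t *: v => Du.
set d := \sum_j _.
suff H : (fun h : R => h^-1 *: (f (p + (h%:A + t) *: v) - f u)) @ 0^' --> d.
  by apply: DeriveDef; [apply: (cvgP d); exact: H|exact: cvg_lim H].
(* [M] plays two roles: |h| M < r keeps the whole axis path in the ball of radius [r], and the
   errors |v_j| e / M add up to at most e. The added 1 makes it positive. *)
pose M : R := \sum_j `|v 0 j| + 1.
have M0 : 0 < M by rewrite ltr_wpDl// sumr_ge0.
apply/cvgrPdist_le => e e0.
have eM : 0 < e / M by rewrite divr_gt0.
have near_u : \forall y \near u, D y /\ (forall i, `|partial i f y - partial i f u| <= e / M).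
  near=> y; split; first by near: y; exact: open_nbhs_nbhs.
  near: y; apply: filter_forall => i.
  by have /cvgrPdistC_le /(_ _ eM) := fc u Du i.
have /nbhs_ballP[r /= r0 ur] := near_u.
have rM : 0 < r / M by rewrite divr_gt0.
near=> h.
have h0 : h != 0 by near: h; exact: nbhs_dnbhs_neq.
have hr : `|h| < r / M.
  near: h; apply: (@nbhs_dnbhs _ 0).
  by apply: filterS (nbhsx_ballx (0 : R) _ rM) => y; rewrite /ball/= sub0r normrN.
have in_ball (y : 'rV[R]_n) : (forall j, `|y 0 j| <= `|v 0 j|) -> ball u r (u + h *: y).
  move=> yv; rewrite -ball_normE /ball_/= opprD addrA subrr sub0r normrN.
  rewrite /Num.norm/= mx_normrE; apply: bigmax_lt => // -[i j] _.
  rewrite ord1 !mxE/= normrM; apply: (@le_lt_trans _ _ (`|h| * M)).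
    rewrite ler_wpM2l// (le_trans (yv j))// /M (bigD1 j)//= -addrA lerDl.
    by rewrite addr_ge0// sumr_ge0.
  by rewrite -ltr_pdivlMr.
pose w (k : nat) := u + h *: trunc k v.
have -> : p + (h%:A + t) *: v = w n.
  rewrite /w (_ : trunc n v = v); last by apply/rowP => j; rewrite !mxE ltn_ord.
  by rewrite /u [h%:A]mulr1 scalerDl [h *: v + _]addrC addrA.
have -> : f u = f (w 0%N).
  by rewrite /w (_ : trunc 0 v = 0) ?scaler0 ?addr0//; apply/rowP => j; rewrite !mxE.
rewrite -(telescope_sumr (fun k => f (w k)))// big_mkord.
rewrite /d [_ *: _]mulr_sumr -sumrB.
apply: (@le_trans _ _ (\sum_(j < n) `|v 0 j| * (e / M))); last first.
  rewrite -mulr_suml mulrCA ger_pMr// ler_pdivrMr// mul1r /M lerDl//.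
apply: le_trans (ler_norm_sum _ _ _) _; apply: ler_sum => j _.
set c := h * v 0 j; set m := partial j f u.
have wS (s : R) : w j + (s * c) *: delta_mx 0 j =
    u + h *: (trunc j v + (s * v 0 j) *: delta_mx 0 j).
  by rewrite /w /c -addrA scalerDr scalerA mulrCA.
have inD (s : R) : 0 <= s <= 1 -> ball u r (w j + (s * c) *: delta_mx 0 j).
  move=> /andP[s0 s1]; rewrite wS; apply: in_ball => i; rewrite !mxE eqxx/=.
  have [->|ij] := eqVneq i j.
    by rewrite ltnn add0r mulr1 normrM ger0_norm// ler_piMl.
  by rewrite mulr0 addr0; case: ifP => // _; rewrite normr0.
(* The linear part with slope at the base point is subtracted, so that the derivative of [g] is
   small and the mean value inequality bounds the error on this axis. *)
pose g (s : R) := f (w j + (s * c) *: delta_mx 0 j) - s * (c * m).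
pose dg (s : R) := c * partial j f (w j + (s * c) *: delta_mx 0 j) - c * m.
have gd (s : R) : 0 <= s <= 1 -> is_derive s 1 g (dg s).
  move=> /inD /ur [Ds _]; apply: is_deriveB.
    by apply: is_derive_partial; exact: fd.
  exact: is_derive_mulr.
have ge (s : R) : 0 <= s <= 1 -> `|dg s| <= `|c| * (e / M).
  move=> /inD /ur [_ Ds]; rewrite /dg -mulrBr normrM ler_wpM2l//; exact: Ds.
have := MVT_bound gd ge (s := 1); rewrite ler01 lexx => /(_ isT).
rewrite /g !mul0r !mul1r scale0r addr0 subr0.
have -> : w j + c *: delta_mx 0 j = w j.+1.
  by have := wS 1; rewrite !mul1r => ->; rewrite /w truncS.
move=> H; rewrite -(@ler_pM2l _ `|h|) ?normr_gt0// -normrM mulrBr mulrA.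
rewrite [h * (h^-1 * _)]mulrA divff// mul1r.
rewrite [leRHS]mulrA -normrM -/c distrC.
by rewrite (_ : _ - _ - _ = f (w j.+1) - f (w j) - c * m) in H; last by ring.
Unshelve. all: by end_near. Qed.

End chain_rule.

Section taylor.
Context {R : realType} {n : nat}.
Implicit Types (f : 'rV[R]_n -> R) (u v w p q : 'rV[R]_n) (D : set 'rV[R]_n).

Lemma smooth_on_partial D f i : smooth_on D f -> smooth_on D (partial i f).
Proof.
by move=> fs s u Du; have := fs (rcons s i) u Du; rewrite /iter_partial foldr_rcons.
Qed.

(** Compact, to bound the derivatives of a smooth function, and convex, to run Taylor's formula
    along segments. *)
Definition crate (al be : 'I_n -> R) : set 'rV[R]_n :=
  [set u | forall j, al j <= u 0 j <= be j].

Lemma crate_line al be p q (s : R) : crate al be p -> crate al be q ->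
  0 <= s <= 1 -> crate al be (p + s *: (q - p)).
Proof.
move=> pK qK /andP[s0 s1] j; rewrite !mxE.
have /andP[p1 p2] := pK j; have /andP[q1 q2] := qK j.
by apply/andP; split; nra.
Qed.

Section on_crate.
Variables (D : set 'rV[R]_n) (al be : 'I_n -> R).
Hypothesis oD : open D.
Hypothesis KD : crate al be `<=` D.
Notation K := (crate al be).

Lemma smooth_on_bounded f : smooth_on D f ->
  exists2 C, 0 <= C & forall u, K u -> `|f u| <= C.
Proof.
move=> fs.
have cK : compact K.
  have := @rV_compact R n (fun j => `[al j, be j]%classic) (fun j => @segment_compact _ _ _).
  by congr compact; apply/seteqP; split => u uK j; have := uK j; rewrite /= in_itv.
have cf : {within K, continuous f}.
  apply: continuous_in_subspaceT => u /set_mem uK.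
  by have [] := fs [::] u (KD uK).
have [M [_ MK]] := compact_bounded (continuous_compact cf cK).
exists (`|M| + 1); first by rewrite addr_ge0.
move=> u uK; apply: MK; last by exists u.
by rewrite ltr_pwDr// ler_norm.
Qed.

Lemma smooth_on_derive f p q (s : R) : smooth_on D f -> K p -> K q ->
  0 <= s <= 1 ->
  is_derive s 1 (fun r : R => f (p + r *: (q - p)))
    (\sum_j (q - p) 0 j * partial j f (p + s *: (q - p))).
Proof.
move=> fs pK qK s01; apply: (is_derive_line oD).
- by move=> u Du i; have [_] := fs [::] u Du; exact.
- by move=> u Du i; have [] := fs [:: i] u Du.
- exact/KD/crate_line.
Qed.

Let sum_bound (F G : 'I_n -> R) (d e : R) : 0 <= d ->
  (forall j, `|F j| <= d) -> (forall j, `|G j| <= e) ->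
  `|\sum_j F j * G j| <= n%:R * (d * e).
Proof.
move=> d0 Fd Ge; apply: le_trans (ler_norm_sum _ _ _) _.
apply: (@le_trans _ _ (\sum_(j < n) d * e)).
  by apply: ler_sum => j _; rewrite normrM; apply: ler_pM.
by rewrite sumr_const card_ord mulr_natl.
Qed.

Let line_endpoints f p q :
  f q - f p = f (p + 1 *: (q - p)) - f (p + 0 *: (q - p)).
Proof. by rewrite scale1r scale0r addr0 addrCA subrr addr0. Qed.

Let line_diff p q (s d : R) : 0 <= s <= 1 ->
  (forall j, `|q 0 j - p 0 j| <= d) ->
  forall j, `|(p + s *: (q - p)) 0 j - p 0 j| <= d.
Proof.
move=> /andP[s0 s1] pq j; rewrite !mxE [X in `|X|]addrC addKr normrM ger0_norm//.
by rewrite (le_trans _ (pq j))// ler_piMl.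
Qed.

Lemma taylor1 f : smooth_on D f -> exists2 C, 0 <= C & forall p q (d : R),
  K p -> K q -> 0 <= d -> (forall j, `|q 0 j - p 0 j| <= d) ->
  `|f q - f p| <= C * d.
Proof.
move=> fs.
have /choice[C CP] : forall j, exists C, 0 <= C /\ forall u, K u -> `|partial j f u| <= C.
  by move=> j; have [C C0 CK] := smooth_on_bounded (smooth_on_partial j fs); exists C.
(* The sum of the nonnegative constants serves as a common upper bound; the same device recurs
   below. *)
pose C1 := \sum_j C j.
have CC1 j : C j <= C1.
  by rewrite /C1 (bigD1 j)//= lerDl sumr_ge0// => i _; have [] := CP i.
have C10 : 0 <= C1 by apply: sumr_ge0 => i _; have [] := CP i.
exists (n%:R * C1); first by rewrite mulr_ge0.
move=> p q d pK qK d0 pq; rewrite line_endpoints.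
apply: (MVT_bound (g := fun r : R => f (p + r *: (q - p)))
  (dg := fun s : R => \sum_j (q - p) 0 j * partial j f (p + s *: (q - p)))); last by rewrite ler01 lexx.
- by move=> s s01; exact: smooth_on_derive.
- move=> s s01; rewrite -mulrA [C1 * d]mulrC; apply: sum_bound => // j.
    by rewrite !mxE.
  by apply: le_trans (CC1 j); have [_] := CP j; apply; exact: crate_line.
Qed.

(** Along the segment the derivative of the remainder is a combination of the increments of the
    partial derivatives, to which [taylor1] applies; the coefficients q_j - p_j supply one more
    factor [d]. *)
Lemma taylor2 f : smooth_on D f -> exists2 C, 0 <= C & forall p q (d : R),
  K p -> K q -> 0 <= d -> (forall j, `|q 0 j - p 0 j| <= d) ->
  `|f q - f p - \sum_j (q 0 j - p 0 j) * partial j f p| <= C * d ^+ 2.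
Proof.
move=> fs.
have /choice[C CP] : forall j, exists C, 0 <= C /\ forall p q (d : R),
    K p -> K q -> 0 <= d -> (forall j, `|q 0 j - p 0 j| <= d) ->
    `|partial j f q - partial j f p| <= C * d.
  by move=> j; have [C C0 CK] := taylor1 (smooth_on_partial j fs); exists C.
pose C1 := \sum_j C j.
have CC1 j : C j <= C1.
  by rewrite /C1 (bigD1 j)//= lerDl sumr_ge0// => i _; have [] := CP i.
have C10 : 0 <= C1 by apply: sumr_ge0 => i _; have [] := CP i.
exists (n%:R * C1); first by rewrite mulr_ge0.
move=> p q d pK qK d0 pq.
pose a := \sum_j (q - p) 0 j * partial j f p.
have -> : \sum_j (q 0 j - p 0 j) * partial j f p = a.
  by apply: eq_bigr => j _; rewrite !mxE.
pose g (r : R) := f (p + r *: (q - p)) - r * a.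
have -> : f q - f p - a = g 1 - g 0.
  by rewrite line_endpoints /g mul1r mul0r subr0 addrAC.
apply: (MVT_bound (dg := fun s : R => \sum_j (q - p) 0 j *
  (partial j f (p + s *: (q - p)) - partial j f p))); last by rewrite ler01 lexx.
- move=> s s01; under eq_bigr do rewrite mulrBr.
  rewrite sumrB; apply: is_deriveB; first exact: smooth_on_derive.
  exact: is_derive_mulr.
- move=> s s01; rewrite (_ : _ * d ^+ 2 = n%:R * (d * (C1 * d))); last by ring.
  apply: sum_bound => // j; first by rewrite !mxE.
  apply: (@le_trans _ _ (C j * d)); last by rewrite ler_wpM2r.
  by have [_] := CP j; apply => //; [exact: crate_line|exact: line_diff].
Qed.

(** Same ascent: the derivative of this remainder at parameter s is a combination of the [taylor2]
    remainders of the partial derivatives at p + s(q - p). *)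
Lemma taylor3 f : smooth_on D f -> exists2 C, 0 <= C & forall p q (d : R),
  K p -> K q -> 0 <= d -> (forall j, `|q 0 j - p 0 j| <= d) ->
  `|f q - f p - \sum_j (q 0 j - p 0 j) * partial j f p
    - 2^-1 * \sum_j (q 0 j - p 0 j) *
        \sum_i (q 0 i - p 0 i) * partial i (partial j f) p| <= C * d ^+ 3.
Proof.
move=> fs.
have /choice[C CP] : forall j, exists C, 0 <= C /\ forall p q (d : R),
    K p -> K q -> 0 <= d -> (forall j, `|q 0 j - p 0 j| <= d) ->
    `|partial j f q - partial j f p - 
      \sum_i (q 0 i - p 0 i) * partial i (partial j f) p| <= C * d ^+ 2.
  by move=> j; have [C C0 CK] := taylor2 (smooth_on_partial j fs); exists C.
pose C1 := \sum_j C j.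
have CC1 j : C j <= C1.
  by rewrite /C1 (bigD1 j)//= lerDl sumr_ge0// => i _; have [] := CP i.
have C10 : 0 <= C1 by apply: sumr_ge0 => i _; have [] := CP i.
exists (n%:R * C1); first by rewrite mulr_ge0.
move=> p q d pK qK d0 pq.
pose a := \sum_j (q - p) 0 j * partial j f p.
pose b := \sum_j (q - p) 0 j * \sum_i (q - p) 0 i * partial i (partial j f) p.
have -> : \sum_j (q 0 j - p 0 j) * partial j f p = a.
  by apply: eq_bigr => j _; rewrite !mxE.
have -> : \sum_j (q 0 j - p 0 j) *
        \sum_i (q 0 i - p 0 i) * partial i (partial j f) p = b.
  apply: eq_bigr => j _; rewrite !mxE; congr (_ * _).
  by apply: eq_bigr => i _; rewrite !mxE.
pose g (r : R) := f (p + r *: (q - p)) - r * a - r ^+ 2 * (2^-1 * b).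
have -> : f q - f p - a - 2^-1 * b = g 1 - g 0.
  rewrite line_endpoints /g expr1n expr0n/= mul1r !mul0r !subr0 mul1r.
  by set X := f _; set Y := f _; ring.
apply: (MVT_bound (dg := fun s : R => \sum_j (q - p) 0 j *
  (partial j f (p + s *: (q - p)) - partial j f p -
     s * \sum_i (q - p) 0 i * partial i (partial j f) p))); last by rewrite ler01 lexx.
- move=> s s01; under eq_bigr do rewrite !mulrBr.
  rewrite !sumrB; apply: is_deriveB.
    apply: is_deriveB; first exact: smooth_on_derive.
  exact: is_derive_mulr.
  under eq_bigr do rewrite mulrCA.
  rewrite -mulr_sumr -/b.
  rewrite (_ : s * b = s *: (2^-1 * b) + (s * (2^-1 * b)) *: 1); last first.
    by rewrite /GRing.scale/=; field.
  under eq_fun do rewrite expr2 -mulrA.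
  apply: (@is_deriveM _ _ id (fun r : R => r * (2^-1 * b))).
  exact: is_derive_mulr.
- move=> s s01; rewrite (_ : _ * d ^+ 3 = n%:R * (d * (C1 * d ^+ 2))); last by ring.
  apply: sum_bound => // j; first by rewrite !mxE.
  apply: (@le_trans _ _ (C j * d ^+ 2)); last by rewrite ler_wpM2r// exprn_ge0.
  have [_ CK] := CP j.
  have := CK p (p + s *: (q - p)) d pK (crate_line pK qK s01) d0 (line_diff s01 pq).
  congr (`|_ - _| <= _); rewrite mulr_sumr; apply: eq_bigr => i _.
  by rewrite !mxE; ring.
Qed.

End on_crate.
End taylor.

(** * The Gaussian Jensen inequality *)

Section admissible.
Context {R : realType}.
Notation N := (@normal_prob R 0 1).

Lemma normal_bounded_integrable (f : R -> R) (C : R) :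
  measurable_fun [set: R] f -> (forall x, `|f x| <= C) ->
  N.-integrable [set: R] (EFin \o f).
Proof. exact: (@bounded_integrable _ (measurableTypeR R) R N). Qed.

Lemma normal_Rintegral_bounded (f : R -> R) (C : R) :
  measurable_fun [set: R] f -> (forall x, `|f x| <= C) -> `|\int[N]_x f x| <= C.
Proof. exact: (@Rintegral_bounded _ (measurableTypeR R) R N). Qed.

(* [g] plays the role of the derivative of [f]; carrying it as data avoids
   differentiating under the integral sign in [admissible_average]. *)
Definition admissible (L al be : R) (f g : R -> R) : Prop :=
  [/\ forall x, al <= f x <= be,
      forall x y, `|f (x + y) - f x| <= L * `|y|,
      forall x, `|g x| <= L
    & forall x y, `|f (x + y) - f x - g x * y| <= L * y ^+ 2].

Lemma lipschitz_continuous_fun (L : R) (f : R -> R) :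
  (forall x y, `|f (x + y) - f x| <= L * `|y|) -> continuous f.
Proof.
move=> fL x; apply/cvgrPdistC_le => e e0; near=> y.
rewrite -(subrKC x y); apply: le_trans (fL _ _) _.
apply: (@le_trans _ _ ((`|L| + 1) * `|y - x|)).
  by rewrite ler_wpM2r// (le_trans (ler_norm _))// lerDl.
rewrite mulrC -ler_pdivlMr ?ltr_wpDl//.
near: y; have d0 : 0 < e / (`|L| + 1) by rewrite divr_gt0// ltr_wpDl.
by apply: filterS (nbhsx_ballx x _ d0) => y; rewrite /ball/= distrC => /ltW.
Unshelve. all: by end_near. Qed.

Section theory.
Variables (L al be : R) (f g : R -> R).
Hypothesis fg : admissible L al be f g.

Lemma admissible_ge0 : 0 <= L.
Proof. by have [_ _ gL _] := fg; exact: le_trans (gL 0). Qed.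

Lemma admissible_continuous : continuous f.
Proof. by have [_ fL _ _] := fg; exact: lipschitz_continuous_fun fL. Qed.

(** Adding the quadratic estimates from x to x + y and back shows that [g] is Lipschitz with
    constant 2L. *)
Lemma admissible_slope_continuous : continuous g.
Proof.
have [_ _ _ H] := fg; apply: (@lipschitz_continuous_fun (L * 2)) => x y.
have [->|y0] := eqVneq y 0; first by rewrite addr0 subrr normr0 mulr0.
rewrite -(@ler_pM2r _ `|y|) ?normr_gt0//.
rewrite (_ : L * 2 * _ * _ = L * y ^+ 2 * 2); last first.
  by rewrite -(real_normK (num_real y)); ring.
rewrite -normrM; have := H x y; have := H (x + y) (- y).
rewrite addrK sqrrN mulrN opprK => H1 H2.
rewrite (_ : (g (x + y) - g x) * y = (f x - f (x + y) + g (x + y) * y) +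
  (f (x + y) - f x - g x * y)); last by ring.
by apply: le_trans (ler_normD _ _) _; lra.
Qed.

Lemma admissible_bound x : `|f x| <= `|al| + `|be|.
Proof.
have [H _ _ _] := fg; have /andP[l u] := H x.
rewrite ler_norml; have := ler_norm be; have := ler_norm (- al).
by rewrite normrN; have := normr_ge0 al; have := normr_ge0 be; lra.
Qed.

Lemma admissible_shift c : admissible L al be (fun x => f (c + x)) (fun x => g (c + x)).
Proof.
by have [H1 H2 H3 H4] := fg; split => // x y; rewrite addrA.
Qed.

(** Every condition bounds an expression linear in the pair (f, g), hence passes to averages with
    unchanged constants. The iteration rests on this. *)
Lemma admissible_average (s : R) :
  admissible L al be (fun x => \int[N]_z f (x + s * z))
    (fun x => \int[N]_z g (x + s * z)).
Proof.
have [H1 H2 H3 H4] := fg.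
have maff x : measurable_fun [set: R] (fun z : R => x + s * z).
  by apply: measurable_funD => //; exact: measurable_funM.
have mf x : measurable_fun [set: R] (fun z => f (x + s * z)).
  apply: (measurableT_comp (f := f)) => //.
  by apply: continuous_measurable_fun; exact: admissible_continuous.
have mg x : measurable_fun [set: R] (fun z => g (x + s * z)).
  apply: (measurableT_comp (f := g)) => //.
  by apply: continuous_measurable_fun; exact: admissible_slope_continuous.
have fi x : N.-integrable [set: R] (EFin \o (fun z => f (x + s * z))).
  by apply: (normal_bounded_integrable (mf x)) => z; exact: admissible_bound.
have gi x : N.-integrable [set: R] (EFin \o (fun z => g (x + s * z))).
  by apply: (normal_bounded_integrable (mg x)) => z; exact: H3.
have ci (c : R) : N.-integrable [set: R] (EFin \o cst c).
  exact: (finite_measure_integrable_cst N c measurableT).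
split.
- move=> x; rewrite -(Rintegral_cst_probability N al) -(Rintegral_cst_probability N be).
  apply/andP; split.
    apply: le_Rintegral; [by []|exact: ci|exact: fi|].
    by move=> z _; have /andP[] := H1 (x + s * z).
  apply: le_Rintegral; [by []|exact: fi|exact: ci|].
  by move=> z _; have /andP[] := H1 (x + s * z).
- move=> x y; rewrite -RintegralB//; apply: normal_Rintegral_bounded.
    exact: measurable_funB.
  by move=> z; rewrite addrAC; exact: H2.
- by move=> x; apply: normal_Rintegral_bounded.
- move=> x y; rewrite -RintegralZr// -!RintegralB//; first last.
  + apply: (normal_bounded_integrable (f := fun z => g (x + s * z) * y) (C := L * `|y|)).
      exact: measurable_funM.
    by move=> z; rewrite normrM ler_wpM2r.
  + exact: (integrableB measurableT (fi _) (fi _)).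
  apply: normal_Rintegral_bounded.
    by apply: measurable_funB; [exact: measurable_funB|exact: measurable_funM].
  by move=> z; rewrite [x + y + _]addrAC; exact: H4.
Qed.

End theory.

(** The quadratic estimate is the mean value inequality for r |-> f(x + r y) - r f'(x) y, whose
    derivative is controlled by the Lipschitz bound on f'. *)
Lemma admissible_C2 (L al be : R) (f f1 f2 : R -> R) :
  (forall x, al <= f x <= be) ->
  (forall x : R, is_derive x 1 f (f1 x)) ->
  (forall x : R, is_derive x 1 f1 (f2 x)) ->
  (forall x, `|f1 x| <= L) -> (forall x, `|f2 x| <= L) ->
  admissible L al be f f1.
Proof.
move=> fab df df1 f1L f2L.
have lip (h h1 : R -> R) : (forall x : R, is_derive x 1 h (h1 x)) ->
    (forall x, `|h1 x| <= L) -> forall x y, `|h (x + y) - h x| <= L * `|y|.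
  move=> dh h1L x y.
  have d (r : R) : 0 <= r <= 1 -> is_derive r 1 (fun r => h (x + r * y)) (h1 (x + r * y) * y).
    move=> _; apply: (@is_derive1_comp _ h (fun r => x + r * y)).
    by rewrite -[y in X in is_derive _ _ _ X]add0r; apply: is_deriveD; exact: is_derive_mulr.
  have b (r : R) : 0 <= r <= 1 -> `|h1 (x + r * y) * y| <= L * `|y|.
    by move=> _; rewrite normrM ler_wpM2r.
  have := MVT_bound d b (s := 1).
  by rewrite ler01 lexx mul1r mul0r addr0 => /(_ isT).
split => //; first exact: lip df f1L.
move=> x y.
have d (r : R) : 0 <= r <= 1 -> is_derive r 1 (fun r => f (x + r * y) - r * (f1 x * y))
    (f1 (x + r * y) * y - f1 x * y).
  move=> _; apply: is_deriveB; last exact: is_derive_mulr.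
  apply: (@is_derive1_comp _ f (fun r => x + r * y)).
  by rewrite -[y in X in is_derive _ _ _ X]add0r; apply: is_deriveD; exact: is_derive_mulr.
have b (r : R) : 0 <= r <= 1 -> `|f1 (x + r * y) * y - f1 x * y| <= L * y ^+ 2.
  move=> /andP[r0 r1]; rewrite -mulrBl normrM -real_normK ?num_real// expr2 mulrA.
  rewrite ler_wpM2r//; apply: le_trans (lip _ _ df1 f2L _ _) _.
  rewrite normrM (ger0_norm r0) ler_wpM2l ?ler_piMl//.
  by apply: le_trans (f1L 0).
have := MVT_bound d b (s := 1).
rewrite ler01 lexx => /(_ isT); rewrite mul1r !mul0r mul1r addr0 subr0.
by congr (`|_| <= _); ring.
Qed.

End admissible.

Lemma cvg_row (R : realType) n T (F : set_system T) {FF : Filter F}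
    (f : 'I_n -> T -> R) (l : 'I_n -> R) :
  (forall j, f j x @[x --> F] --> l j) ->
  (\row_j f j x : 'rV[R]_n) @[x --> F] --> (\row_j l j : 'rV[R]_n).
Proof.
move=> fl; apply/cvgrPdist_le => e e0; near=> x.
rewrite /Num.norm/= mx_normrE; apply: bigmax_le => [|[i j] _]; first exact: ltW.
rewrite !mxE/=; move: (j); near: x; apply: filter_forall => {}j.
by have /cvgrPdist_le := fl j; apply.
Unshelve. all: by end_near. Qed.

Lemma integrable_sum_fin d (T : measurableType d) (R : realType)
    (mu : {measure set T -> \bar R}) (I : finType) (F : I -> T -> R) :
  (forall i, mu.-integrable [set: T] (EFin \o F i)) ->
  mu.-integrable [set: T] (EFin \o (fun x => \sum_i F i x)).
Proof.
move=> Fi; rewrite (_ : EFin \o _ = (fun x => \sum_(i <- index_enum I) (F i x)%:E)%E).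
  by apply: integrable_sum => // i *; exact: Fi.
by apply/funext => x; rewrite /= -sumEFin.
Qed.

Lemma Rintegral_sum d (T : measurableType d) (R : realType)
    (mu : {measure set T -> \bar R}) (I : finType) (F : I -> T -> R) :
  (forall i, mu.-integrable [set: T] (EFin \o F i)) ->
  \int[mu]_x \sum_i F i x = \sum_i \int[mu]_x F i x.
Proof.
move=> Fi; pose s := index_enum I.
rewrite -/s; elim: s => [|i s ih].
  rewrite big_nil (_ : (fun x => _) = cst 0); last by apply/funext => x; rewrite big_nil.
  by rewrite /Rintegral integral0.
rewrite big_cons -ih -RintegralD//.
  by apply: eq_Rintegral => x _; rewrite big_cons.
rewrite (_ : EFin \o _ = (fun x => \sum_(j <- s) (F j x)%:E)%E).
  by apply: integrable_sum => // j *; exact: Fi.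
by apply/funext => x; rewrite /= -sumEFin.
Qed.

Section box_topology.
Context {R : realType} {n : nat}.
Variable I : 'I_n -> set R.

Lemma open_box : (forall j, open (I j)) -> open (box I).
Proof.
move=> oI; rewrite openE => u uI; rewrite /interior.
have H : \forall y \near u, forall j, I j ((y : 'rV[R]_n) 0 j).
  have FF : Filter (nbhs u) by exact: nbhs_filter.
  apply: (@filter_forall _ _ (fun j (y : 'rV[R]_n) => I j (y 0 j)) _ FF) => j.
  have Ij : nbhs (u 0 j) (I j).
    by apply: open_nbhs_nbhs; split; [exact: oI|exact: uI].
  exact: (@coord_continuous R 1 n 0 j u _ Ij).
exact: H.
Qed.

Lemma crate_sub_box (al be : 'I_n -> R) : (forall j, is_interval (I j)) ->
  (forall j, I j (al j)) -> (forall j, I j (be j)) -> crate al be `<=` box I.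
Proof. by move=> iI Ia Ib u uK j; exact: (iI j _ _ (Ia j) (Ib j) _ (uK j)). Qed.

End box_topology.

Section composite.
Context {R : realType} {k n : nat}.
Notation tup := (k.-tuple (measurableTypeR R)).
Variables (I : 'I_n -> set R) (B : 'rV[R]_n -> R) (a : 'I_n -> 'cV[R]_k).
Hypothesis sB : smooth_on (box I) B.

(** The integrand is a function of the coordinates that is continuous on all of R^k, because the
    [f j] keep the argument of B inside the box. *)
Lemma measurable_composite (f : 'I_n -> R -> R) :
  (forall j, continuous (f j)) -> (forall j t, I j (f j t)) ->
  measurable_fun [set: tup] (fun x => B (\row_j f j (dot (a j) (vec_of x)))).
Proof.
move=> cf fI.
pose phi (r : 'rV[R]_k) := B (\row_j f j (\sum_i a j i 0 * r 0 i)).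
rewrite (_ : (fun x => _) = phi \o @row_of R k).
  apply: measurable_continuous_tuple => r.
  have Br : box I (\row_j f j (\sum_i a j i 0 * r 0 i)).
    by move=> j; rewrite mxE.
  have [cB _] := sB [::] Br.
  have FF : Filter (nbhs r) by exact: nbhs_filter.
  apply: (cvg_comp (fun r : 'rV[R]_k => \row_j f j (\sum_i a j i 0 * r 0 i)) B _ cB).
  apply: (@cvg_row _ _ _ (nbhs r) FF (fun j (r : 'rV[R]_k) => f j (\sum_i a j i 0 * r 0 i))).
  move=> j; apply: (cvg_comp (fun r : 'rV[R]_k => \sum_i a j i 0 * r 0 i) (f j) _ (cf j _)).
  move: r {Br cB FF}.
  apply: continuous_big => [|i _ r].
    by move=> z; apply: cvgD; [exact: cvg_fst|exact: cvg_snd].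
  apply: (@cvgM _ _ (nbhs r) _ (fun=> a j i 0) (fun x : 'rV[R]_k => x 0 i)).
    exact: cvg_cst.
  exact: coord_continuous.
apply/funext => x; rewrite /phi /=; congr B; apply/rowP => j; rewrite !mxE.
by congr (f j _); apply: eq_bigr => i _; rewrite !mxE.
Qed.

End composite.

(** * Expansion at a small scale and the doubling argument *)

Section one_step.
Context {R : realType} {k n : nat}.
Notation N := (@normal_prob R 0 1).
Notation G := (@gaussian_measure R k).
Notation tup := (k.-tuple (measurableTypeR R)).
Variables (I : 'I_n -> set R) (B : 'rV[R]_n -> R) (a : 'I_n -> 'cV[R]_k).
Variables (al be : 'I_n -> R) (L : R).
Hypothesis oI : forall j, open (I j).
Hypothesis iI : forall j, is_interval (I j).
Hypothesis sB : smooth_on (box I) B.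
Hypothesis Ial : forall j, I j (al j).
Hypothesis Ibe : forall j, I j (be j).
Hypothesis n_gt0 : (0 < n)%N.

Notation adm f g := (forall j, admissible L (al j) (be j) (f j) (g j)).

Let KD : crate al be `<=` box I := crate_sub_box iI Ial Ibe.

Let adm_crate (f g : 'I_n -> R -> R) (t : 'I_n -> R) : adm f g ->
  crate al be (\row_j f j (t j)).
Proof. by move=> fg j; rewrite mxE; have [H _ _ _] := fg j; exact: H. Qed.

(** The quadratic form of A^*A • Hess B(p) at the vector g, where the [a j] are the columns of A. *)
Definition schur_form (g : 'I_n -> R) (p : 'rV[R]_n) : R :=
  \sum_j \sum_i dot (a j) (a i) * (g j * g i * partial i (partial j B) p).

(** Pointwise version, with y_j later equal to a_j.x. The increments of the [f j] stay unexpanded in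
    the linear term, where they will match those of Q exactly; only in the quadratic term are they
    replaced by s y_j g_j(0). *)
Lemma second_order_expansion : exists2 C : R, 0 <= C &
  forall (f g : 'I_n -> R -> R) (s m : R) (y : 'I_n -> R),
  adm f g -> 0 <= s -> 0 <= m -> (forall j, `|y j| <= m) -> forall p, p = \row_j f j 0 ->
  `|B (\row_j f j (s * y j)) - (B p
    + \sum_j (f j (s * y j) - f j 0) * partial j B p
    + s ^+ 2 / 2 * \sum_j \sum_i (y j * y i) *
        (g j 0 * g i 0 * partial i (partial j B) p))| <= C * s ^+ 3 * m ^+ 3.
Proof.
have [C3 C30 T3] := taylor3 (open_box oI) KD sB.
have /choice[C CP] : forall ij : 'I_n * 'I_n, exists C : R, 0 <= C /\
    forall u, crate al be u -> `|partial ij.1 (partial ij.2 B) u| <= C.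
  move=> ij; have sBij := smooth_on_partial ij.1 (smooth_on_partial ij.2 sB).
  by have [C C0 CK] := smooth_on_bounded KD sBij; exists C.
pose CH := \sum_ij C ij.
have CC ij : C ij <= CH.
  by rewrite /CH (bigD1 ij)//= lerDl sumr_ge0// => i _; have [] := CP i.
have CH0 : 0 <= CH by apply: sumr_ge0 => i _; have [] := CP i.
clearbody CH.
(* The first summand is the [taylor3] remainder with d = L s m. The second collects n^2
   replacements, each off by 2 L^2 (s m)^3 [CH] before the factor 1/2. The absolute value is there
   because L >= 0 is known only once an admissible pair is given. *)
exists (C3 * `|L| ^+ 3 + n%:R * (n%:R * (L ^+ 2 * CH))).
  apply: addr_ge0; first by rewrite mulr_ge0 ?exprn_ge0.
  by rewrite mulr_ge0// mulr_ge0// mulr_ge0// sqr_ge0.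
move=> f g s m y fg s0 m0 ym p pE.
have L0 : 0 <= L by exact: admissible_ge0 (fg (Ordinal n_gt0)).
pose e j := f j (s * y j) - f j 0.
have pK : crate al be p by rewrite pE; exact: (@adm_crate f g (fun=> 0)).
have sy j : `|s * y j| <= s * m by rewrite normrM ger0_norm// ler_wpM2l.
have e1 j : `|e j| <= L * (s * m).
  have [_ H _ _] := fg j; have := H 0 (s * y j); rewrite add0r => /le_trans; apply.
  by rewrite ler_wpM2l.
have e2 j : `|e j - g j 0 * (s * y j)| <= L * (s * m) ^+ 2.
  have [_ _ _ H] := fg j; have := H 0 (s * y j); rewrite add0r => /le_trans; apply.
  by rewrite ler_wpM2l// -real_normK ?num_real// lerXn2r ?nnegrE ?mulr_ge0.
have gL j : `|g j 0| <= L by have [_ _ H _] := fg j; exact: H.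
have sm0 : 0 <= s * m by rewrite mulr_ge0.
have e1' j : `|(\row_j f j (s * y j)) 0 j - p 0 j| <= L * (s * m).
  by rewrite pE !mxE; exact: e1.
have := T3 p (\row_j f j (s * y j)) (L * (s * m)) pK
  (@adm_crate f g (fun j => s * y j) fg) (mulr_ge0 L0 sm0) e1'.
set Q := B _; set b1 := \sum_j _ * partial j B p; set b2 := (X in 2^-1 * X) => H.
rewrite (_ : \sum_j e j * partial j B p = b1); last first.
  by apply: eq_bigr => j _; rewrite pE !mxE.
set b3 := (X in s ^+ 2 / 2 * X).
have H2 : `|b2 - s ^+ 2 * b3| <= n%:R * (n%:R * ((L ^+ 2 * (s * m) ^+ 3 * 2) * CH)).
  rewrite /b2 /b3 mulr_sumr -sumrB; apply: le_trans (ler_norm_sum _ _ _) _.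
  apply: (@le_trans _ _ (\sum_(j < n) n%:R * ((L ^+ 2 * (s * m) ^+ 3 * 2) * CH))); last first.
    by rewrite sumr_const card_ord [leRHS]mulr_natl.
  apply: ler_sum => j _; rewrite !mulr_sumr -sumrB.
  apply: le_trans (ler_norm_sum _ _ _) _.
  apply: (@le_trans _ _ (\sum_(i < n) (L ^+ 2 * (s * m) ^+ 3 * 2) * CH)); last first.
    by rewrite sumr_const card_ord [leRHS]mulr_natl.
  apply: ler_sum => i _; set h := partial i _ _.
  rewrite pE !mxE -/(e j) -/(e i).
  (* A difference of two products, split so that each summand has one factor of order s m and one of
     order (s m)^2. *)
  rewrite (_ : _ - _ = (e j * (e i - g i 0 * (s * y i)) +
    (g i 0 * (s * y i)) * (e j - g j 0 * (s * y j))) * h); last by ring.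
  rewrite normrM; apply: ler_pM => //; last first.
    by apply: le_trans (CC (i, j)); have [_] := CP (i, j); apply.
  apply: le_trans (ler_normD _ _) _; rewrite !normrM.
  rewrite (_ : L ^+ 2 * (s * m) ^+ 3 * 2 = (L * (s * m)) * (L * (s * m) ^+ 2) +
    (L * (s * m)) * (L * (s * m) ^+ 2)); last by ring.
  apply: lerD; apply: ler_pM => //.
  by apply: ler_pM => //; rewrite -normrM.
rewrite (_ : Q - _ = (Q - B p - b1 - 2^-1 * b2) + 2^-1 * (b2 - s ^+ 2 * b3)); last by field.
apply: le_trans (ler_normD _ _) _; rewrite normrM (ger0_norm (_ : 0 <= 2^-1))//.
rewrite (ger0_norm L0) !mulrDl; apply: lerD.
  by apply: le_trans H _; rewrite !exprMn !mulrA.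
rewrite -ler_pdivlMl ?invr_gt0// invrK; apply: le_trans H2 _.
rewrite le_eqVlt; apply/orP; left; apply/eqP; ring.
Qed.

Hypothesis unit_a : forall j, enorm (a j) = 1.

Let Rintegral_dist_le d (T : measurableType d) (P : {measure set T -> \bar R})
    (F W H : T -> R) :
  P.-integrable [set: T] (EFin \o F) -> P.-integrable [set: T] (EFin \o W) ->
  P.-integrable [set: T] (EFin \o H) -> (forall x, `|F x - W x| <= H x) ->
  `|\int[P]_x F x - \int[P]_x W x| <= \int[P]_x H x.
Proof.
move=> iF iW iH FWH; have iFW := integrableB measurableT iF iW.
rewrite -RintegralB//; apply: (le_trans (le_normr_Rintegral _ iFW)) => //.
apply: le_Rintegral => //; exact: (@integrable_abse _ _ _ P _ _ iFW).
Qed.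

Let integrable_Zl d (T : measurableType d) (P : {measure set T -> \bar R})
    (F : T -> R) (c : R) : P.-integrable [set: T] (EFin \o F) ->
  P.-integrable [set: T] (EFin \o (fun x => c * F x)).
Proof. by move=> /(integrableZl measurableT c); exact: eq_integrable. Qed.

Let integrable_Zr d (T : measurableType d) (P : {measure set T -> \bar R})
    (F : T -> R) (c : R) : P.-integrable [set: T] (EFin \o F) ->
  P.-integrable [set: T] (EFin \o (fun x => F x * c)).
Proof. by move=> /(integrableZr measurableT c); exact: eq_integrable. Qed.

(** The linear term g_j(0) s z has mean zero, so the mean moves only at order s^2. *)
Let mean_close (f g : 'I_n -> R -> R) (s : R) j : adm f g ->
  `|\int[N]_z f j (s * z) - f j 0| <= L * s ^+ 2 * normal_variance.
Proof.
move=> fg; have [_ _ _ H] := fg j.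
have mf : measurable_fun [set: R] (fun z => f j (s * z)).
  apply: (measurableT_comp (f := f j)); last exact: measurable_funM.
  by apply: continuous_measurable_fun; exact: admissible_continuous (fg j).
have if_ : N.-integrable [set: R] (EFin \o (fun z => f j (s * z))).
  by apply: (normal_bounded_integrable mf) => z; exact: (admissible_bound (fg j)).
have ic : N.-integrable [set: R] (EFin \o cst (f j 0)).
  exact: (finite_measure_integrable_cst N _ measurableT).
have iz : N.-integrable [set: R] (EFin \o (fun z => g j 0 * s * z)).
  by apply: (@integrable_Zl _ _ N id); exact: normal_integrable_id.
have i2 : N.-integrable [set: R] (EFin \o (fun z => L * s ^+ 2 * z ^+ 2)).
  by apply: (@integrable_Zl _ _ N (fun z => z ^+ 2)); exact: normal_integrable_sqr.
have iW := integrableD measurableT ic iz.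
have := @Rintegral_dist_le _ _ N (fun z => f j (s * z)) (fun z => f j 0 + g j 0 * s * z)
  (fun z => L * s ^+ 2 * z ^+ 2) if_ iW i2.
rewrite RintegralD// (Rintegral_cst_probability N) !RintegralZl//; first last.
- exact: normal_integrable_id.
- exact: normal_integrable_sqr.
rewrite normal_mean0 mulr0 addr0; apply => z.
by have := H 0 (s * z); rewrite add0r exprMn !mulrA opprD addrA.
Qed.

Notation xi j x := (dot (a j) (vec_of x)).

(** Turns the factor m^3 of the pointwise estimate into an integrable function: the cube of the
    largest |a_j.x| is one term of the sum. *)
Let max_cube (x : tup) : exists2 m, 0 <= m &
  (forall j, `|xi j x| <= m) /\ m ^+ 3 <= \sum_j `|xi j x| ^+ 3.
Proof.
pose i0 := Ordinal n_gt0.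
case: (@arg_maxP _ _ _ i0 predT (fun j => `|xi j x|) isT) => j _ jmax.
exists `|xi j x| => //; split; first by move=> i; exact: jmax.
by rewrite (bigD1 j)//= lerDl sumr_ge0// => i _; rewrite exprn_ge0.
Qed.

Lemma one_step : exists2 C : R, 0 <= C &
  forall (f g : 'I_n -> R -> R) (s : R), adm f g -> 0 <= s <= 1 ->
  `|\int[G]_x B (\row_j f j (s * xi j x)) - B (\row_j \int[N]_z f j (s * z))
    - s ^+ 2 / 2 * normal_variance *
      schur_form (fun j => g j 0) (\row_j f j 0)| <= C * s ^+ 3.
Proof.
have [C1 C10 H1] := second_order_expansion.
have [C2 C20 H2] := taylor2 (open_box oI) KD sB.
have [CB _ HB] := smooth_on_bounded KD sB.
pose v : R := normal_variance.
have v0 : 0 <= v by exact/ltW/normal_variance_gt0.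
have c0 : 0 <= normal_cube :> R by apply: Rintegral_ge0 => x _; rewrite exprn_ge0.
(* First the integral of the pointwise error; then the [taylor2] error of Q, whose argument moves by
   at most L v s^2, so that it is of order s^4, hence of order s^3 for s <= 1. *)
exists (C1 * (n%:R * normal_cube) + C2 * (L * v) ^+ 2).
  apply: addr_ge0; apply: mulr_ge0 => //; [exact: mulr_ge0|exact: sqr_ge0].
move=> f g s fg /andP[s0 s1].
have L0 : 0 <= L by exact: admissible_ge0 (fg (Ordinal n_gt0)).
pose p := \row_j f j 0.
pose mean j := \int[N]_z f j (s * z).
pose b2 := \sum_j (mean j - f j 0) * partial j B p.
have cf j : continuous (fun t => f j (s * t)).
  move=> t; apply: (@continuous_comp _ _ _ (fun t => s * t) (f j)).
    by apply: cvgM; [exact: cvg_cst|exact: cvg_id].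
  exact: (admissible_continuous (fg j)).
have inI (t : 'I_n -> R) j : I j (f j (t j)).
  by have [H _ _ _] := fg j; apply: (iI (Ial j) (Ibe j)); exact: H.
have mF : measurable_fun [set: tup] (fun x => B (\row_j f j (s * xi j x))).
  exact: (@measurable_composite _ _ _ I B a sB (fun j t => f j (s * t)) cf
    (fun j t => inI (fun=> s * t) j)).
have iF : G.-integrable [set: tup] (EFin \o (fun x => B (\row_j f j (s * xi j x)))).
  apply: (bounded_integrable G mF (C := CB)) => x; apply: HB.
  exact: (@adm_crate f g (fun j => s * xi j x)).
have mf j : measurable_fun [set: R] (fun t => f j (s * t)).
  exact: continuous_measurable_fun.
have ie j : G.-integrable [set: tup] (EFin \o (fun x => f j (s * xi j x))).
  apply: (@bounded_integrable _ _ _ G _ (`|al j| + `|be j|)).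
    by apply: (measurableT_comp (mf j)); exact: measurable_dot.
  by move=> x; exact: (admissible_bound (fg j)).
have ic (c : R) : G.-integrable [set: tup] (EFin \o cst c).
  exact: (finite_measure_integrable_cst G _ measurableT).
have iej j : G.-integrable [set: tup]
    (EFin \o (fun x => (f j (s * xi j x) - f j 0) * partial j B p)).
  apply: (@integrable_Zr _ _ G (fun x => f j (s * xi j x) - f j 0)).
  exact: (integrableB measurableT (ie j) (ic (f j 0))).
pose h j i := g j 0 * g i 0 * partial i (partial j B) p.
have ixx j i : G.-integrable [set: tup] (EFin \o (fun x => xi j x * xi i x * h j i)).
  by apply: integrable_Zr; exact: gaussian_integrable_prod.
have ixs j : G.-integrable [set: tup] (EFin \o (fun x => \sum_i xi j x * xi i x * h j i)).
  by apply: integrable_sum_fin => i; exact: ixx.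
have iS1 : G.-integrable [set: tup]
    (EFin \o (fun x => \sum_j (f j (s * xi j x) - f j 0) * partial j B p)).
  exact: integrable_sum_fin.
have iS2 : G.-integrable [set: tup]
    (EFin \o (fun x => \sum_j \sum_i xi j x * xi i x * h j i)).
  exact: integrable_sum_fin.
have iS2' : G.-integrable [set: tup]
    (EFin \o (fun x => s ^+ 2 / 2 * \sum_j \sum_i xi j x * xi i x * h j i)).
  exact: integrable_Zl.
have iT : G.-integrable [set: tup] (EFin \o (fun x => C1 * s ^+ 3 * \sum_j `|xi j x| ^+ 3)).
  apply: integrable_Zl; apply: integrable_sum_fin => j.
  exact: gaussian_integrable_cube.
have iW1 := integrableD measurableT (ic (B p)) iS1.
have iW := integrableD measurableT iW1 iS2'.
have main := @Rintegral_dist_le _ _ G (fun x => B (\row_j f j (s * xi j x)))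
  (fun x => B p + \sum_j (f j (s * xi j x) - f j 0) * partial j B p
    + s ^+ 2 / 2 * \sum_j \sum_i xi j x * xi i x * h j i)
  (fun x => C1 * s ^+ 3 * \sum_j `|xi j x| ^+ 3) iF iW iT.
have intW : \int[G]_x (B p + \sum_j (f j (s * xi j x) - f j 0) * partial j B p
    + s ^+ 2 / 2 * \sum_j \sum_i xi j x * xi i x * h j i) =
    B p + b2 + s ^+ 2 / 2 * (v * schur_form (fun j => g j 0) p).
  rewrite RintegralD// RintegralD//; last exact: ic.
  rewrite (Rintegral_cst_probability G) RintegralZl//; congr (_ + _ + _ * _).
    rewrite Rintegral_sum//; apply: eq_bigr => j _.
    rewrite RintegralZr//; last exact: (integrableB measurableT (ie j) (ic (f j 0))).
    congr (_ * _); rewrite RintegralB//; last exact: ic.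
    rewrite (Rintegral_cst_probability G); congr (_ - _).
    (* As [a j] is a unit vector, its marginal is standard normal; thus [b2] is also the linear term
       in the expansion of Q. *)
    rewrite (@gaussian_Rintegral_marginal _ _ (a j) (fun t => f j (s * t)) (`|al j| + `|be j|))//.
      by rewrite unit_a; apply: eq_Rintegral => z _; rewrite mul1r.
    by move=> x; exact: (admissible_bound (fg j)).
  rewrite Rintegral_sum// /schur_form mulr_sumr; apply: eq_bigr => j _.
  rewrite Rintegral_sum// mulr_sumr; apply: eq_bigr => i _.
  rewrite RintegralZr//; last exact: gaussian_integrable_prod.
  by rewrite gaussian_covariance mulrAC mulrC /h.
have intT : \int[G]_x (C1 * s ^+ 3 * \sum_j `|xi j x| ^+ 3) =
    C1 * s ^+ 3 * (n%:R * normal_cube).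
  rewrite RintegralZl//; last first.
    by apply: integrable_sum_fin => j; exact: gaussian_integrable_cube.
  congr (_ * _); rewrite Rintegral_sum; last by move=> j; exact: gaussian_integrable_cube.
  under eq_bigr do rewrite gaussian_Rintegral_cube unit_a expr1n mul1r.
  by rewrite sumr_const card_ord mulr_natl.
rewrite intW intT in main.
have {}main : `|\int[G]_x B (\row_j f j (s * xi j x)) -
    (B p + b2 + s ^+ 2 / 2 * (v * schur_form (fun j => g j 0) p))| <=
    C1 * s ^+ 3 * (n%:R * normal_cube).
  apply: main => x; have [m m0 [xm mT]] := max_cube x.
  apply: le_trans (H1 f g s m (fun j => xi j x) fg s0 m0 xm p erefl) _.
  by rewrite ler_wpM2l// mulr_ge0// exprn_ge0.
pose d := L * s ^+ 2 * v.
have d0 : 0 <= d by rewrite /d !mulr_ge0// sqr_ge0.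
have pK : crate al be p by exact: (@adm_crate f g (fun=> 0)).
have qK : crate al be (\row_j mean j).
  move=> j; rewrite mxE; have [H _ _ _] := admissible_average (fg j) s.
  by have := H 0; rewrite /mean; under eq_Rintegral do rewrite add0r.
have qp j : `|(\row_j mean j) 0 j - p 0 j| <= d.
  by rewrite !mxE; exact: mean_close fg.
have := H2 p (\row_j mean j) d pK qK d0 qp.
rewrite (_ : \sum_j _ = b2); last by apply: eq_bigr => j _; rewrite !mxE.
set Q := B (\row_j mean j); set J := \int[G]_x _ in main *.
rewrite -/v -/p; set S := schur_form _ _ in main *.
move=> H; rewrite (_ : J - Q - _ = (J - (B p + b2 + s ^+ 2 / 2 * (v * S))) -
  (Q - B p - b2)); last by ring.
apply: le_trans (ler_normB _ _) _; rewrite mulrDl; apply: lerD.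
  by apply: le_trans main _; rewrite mulrAC.
apply: le_trans H _; rewrite -mulrA ler_wpM2l//.
rewrite (_ : d ^+ 2 = (L * v) ^+ 2 * s ^+ 4); last by rewrite /d; ring.
by rewrite ler_wpM2l ?sqr_ge0// exprSr ler_piMr// exprn_ge0.
Qed.

(** The defect [M] is uniform over the class: doubling applies the inequality to functions other
    than the given ones. *)
Definition gaussian_jensen (s M : R) : Prop := forall f g : 'I_n -> R -> R,
  adm f g ->
  \int[G]_x B (\row_j f j (s * xi j x)) <= B (\row_j \int[N]_z f j (s * z)) + M.

Lemma gaussian_jensen_small :
  (forall u v, box I u -> schur_form v u <= 0) ->
  exists2 C, 0 <= C & forall s, 0 <= s <= 1 -> gaussian_jensen s (C * s ^+ 3).
Proof.
move=> neg; have [C C0 H] := one_step; exists C => // s s01 f g fg.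
have := H f g s fg s01; set S := schur_form _ _.
have S0 : s ^+ 2 / 2 * normal_variance * S <= 0.
  apply: mulr_ge0_le0.
    by apply: mulr_ge0; [rewrite divr_ge0// sqr_ge0|exact/ltW/normal_variance_gt0].
  by apply: neg; apply: KD; exact: (@adm_crate f g (fun=> 0)).
by move=> /(le_trans (ler_norm _)); lra.
Qed.

Let adm_cont (f g : 'I_n -> R -> R) (c : R) : adm f g ->
  forall j, continuous (fun t => f j (c * t)).
Proof.
move=> fg j t; apply: (@continuous_comp _ _ _ (fun t => c * t) (f j)).
  by apply: cvgM; [exact: cvg_cst|exact: cvg_id].
exact: (admissible_continuous (fg j)).
Qed.

Let adm_measurable (f g : 'I_n -> R -> R) (c : R) : adm f g ->
  measurable_fun [set: tup] (fun x => B (\row_j f j (c * xi j x))).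
Proof.
move=> fg; apply: (@measurable_composite _ _ _ I B a sB (fun j t => f j (c * t))).
  exact: adm_cont fg.
by move=> j t; have [H _ _ _] := fg j; apply: (iI (Ial j) (Ibe j)); exact: H.
Qed.

(** Each of two nested uses costs [M]: over Y with X frozen, for the translates of the [f j]; then
    over X, for their averages [F j]. *)
Lemma gaussian_jensen_double (s M : R) : gaussian_jensen s M ->
  gaussian_jensen (Num.sqrt 2 * s) (M + M).
Proof.
move=> J f g fg; have [CB _ HB] := smooth_on_bounded KD sB.
(* With this [c] the vector c X + c Y is again standard Gaussian, and at scale sqrt(2) s it becomes
   s X + s Y. *)
pose c : R := (Num.sqrt 2)^-1.
have s2 : Num.sqrt 2 != 0 :> R by rewrite gt_eqF// sqrtr_gt0.
have cc : c ^+ 2 + c ^+ 2 = 1.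
  by rewrite /c exprVn sqr_sqrtr//; field.
have sc t : Num.sqrt 2 * s * (c * t) = s * t by rewrite /c; field.
pose phi x := B (\row_j f j (Num.sqrt 2 * s * xi j x)).
have mphi : measurable_fun [set: tup] phi by exact: adm_measurable fg.
have phiC x : `|phi x| <= CB.
  by apply: HB; exact: (@adm_crate f g (fun j => Num.sqrt 2 * s * xi j x)).
have phiE x y : phi (lincomb c c x y) = B (\row_j f j (s * xi j x + s * xi j y)).
  congr B; apply/rowP => j; rewrite !mxE; congr (f j _).
  by rewrite vec_of_lincomb mulrDr !sc.
pose F j t := \int[N]_z f j (t + s * z).
pose F' j t := \int[N]_z g j (t + s * z).
have FF' : adm F F' by move=> j; exact: admissible_average.
have iF : G.-integrable [set: tup] (EFin \o (fun x => B (\row_j F j (s * xi j x)))).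
  apply: (bounded_integrable G (adm_measurable s FF') (C := CB)) => x; apply: HB.
  exact: (@adm_crate F F' (fun j => s * xi j x)).
have iM : G.-integrable [set: tup] (EFin \o cst M).
  exact: (finite_measure_integrable_cst G _ measurableT).
rewrite (gaussian_Rintegral_rotation cc mphi phiC).
apply: (@le_trans _ _ (\int[G]_x (B (\row_j F j (s * xi j x)) + M))).
  apply: le_Rintegral => //.
  - apply: (bounded_integrable G (C := CB)).
      apply: (@measurable_Rintegral _ _ tup tup R G (fun z => phi (lincomb c c z.1 z.2)) CB) => //.
      by apply: (measurableT_comp mphi); exact: measurable_lincomb.
    move=> x; apply: Rintegral_bounded => //.
    by apply: (measurableT_comp mphi); exact: measurable_lincomb.
  - exact: (integrableD measurableT iF iM).
  - move=> x _; under eq_Rintegral do rewrite phiE.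
    exact: (J (fun j t => f j (s * xi j x + t)) _ (fun j => admissible_shift (fg j) _)).
rewrite RintegralD// (Rintegral_cst_probability G) addrA lerD2r.
apply: le_trans (J F F' FF') _; rewrite lerD2r le_eqVlt; apply/orP; left; apply/eqP.
congr B; apply/rowP => j; rewrite !mxE.
(* The mean of [F j] is a double average over s z + s z', which the one-dimensional rotation turns
   back into scale sqrt(2) s. *)
rewrite [RHS](@normal_Rintegral_rotation _ c c (fun z => f j (Num.sqrt 2 * s * z))
  (`|al j| + `|be j|) cc).
- by do 2 (apply: eq_Rintegral => ? _); rewrite mulrDr !sc.
- by apply: continuous_measurable_fun; exact: adm_cont fg j.
- by move=> x; exact: (admissible_bound (fg j)).
Qed.

Lemma gaussian_jensen_admissible :
  (forall u v, box I u -> schur_form v u <= 0) -> gaussian_jensen 1 0.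
Proof.
move=> /gaussian_jensen_small[C C0 J].
have JS r (s M : R) : gaussian_jensen s M -> gaussian_jensen (2 ^+ r * s) (4 ^+ r * M).
  elim: r s M => [|r ih] s M; first by rewrite !mul1r.
  move=> /gaussian_jensen_double/gaussian_jensen_double.
  rewrite mulrA -expr2 sqr_sqrtr// (_ : M + M + _ = 4 * M); last by ring.
  by move=> /ih; rewrite !mulrA -!exprSr.
move=> f g fg; rewrite addr0; apply/ler_addgt0Pr => e e0.
have [r Cr] : exists r, C * 2^-1 ^+ r <= e.
  (* The exponent works because C / e <= r <= 2^r. *)
  exists (Num.bound (C / e)); set r := Num.bound _.
  have Cr : C / e <= 2 ^+ r.
    apply: (@le_trans _ _ r%:R); first by rewrite ltW// archi_boundP// divr_ge0// ltW.
    by rewrite -natrX ler_nat ltnW// ltn_expl.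
  by rewrite exprVn ler_pdivrMr ?exprn_gt0// mulrC -ler_pdivrMr.
have s01 : 0 <= (2^-1 : R) ^+ r <= 1.
  by rewrite exprn_ge0//= exprn_ile1// invf_le1// ler1n.
have := JS r _ _ (J _ s01) f g fg.
rewrite -exprMn divff// expr1n => /le_trans; apply; rewrite lerD2l.
rewrite (_ : 4 ^+ r * _ = C * 2^-1 ^+ r)//.
rewrite mulrCA; congr (_ * _).
by rewrite -exprM mulnC exprM -exprMn; congr (_ ^+ _); field.
Qed.

End one_step.

(** * From the class to smooth bounded functions *)

Section means.
Context {R : realType}.
Notation N := (@normal_prob R 0 1).

Lemma normal_Rintegral_gt0 (h : R -> R) (C : R) : measurable_fun [set: R] h ->
  (forall x, `|h x| <= C) -> (forall x, 0 < h x) -> 0 < \int[N]_x h x.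
Proof.
move=> mh hC h0.
have ih := normal_bounded_integrable mh hC.
have v0 : 0 <= \int[N]_x h x by apply: Rintegral_ge0 => x _; exact: ltW.
rewrite lt_neqAle v0 andbT eq_sym; apply/eqP => v_eq0.
have i2 : (\int[N]_x `|(h x)%:E| = 0)%E.
  transitivity (\int[N]_x (h x)%:E)%E.
    by apply: eq_integral => x _; rewrite gee0_abs// lee_fin ltW.
  rewrite -[LHS]fineK; first exact: (congr1 EFin v_eq0).
  exact: integrable_fin_num.
have m2 : measurable_fun [set: R] (EFin \o h) by exact/measurable_EFinP.
have /(ae_eq_integral_abs N measurableT m2) [A [mA A0 sA]] := i2.
have AT : A = [set: R].
  apply/seteqP; split => // x _; apply: sA => /= /(_ I) [] hx.
  by have := h0 x; rewrite hx ltxx.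
have N1 : N [set: R] = 1%E by exact: (probability_setT N).
have : (1 <= 0 :> \bar R)%E by rewrite -N1 -A0 AT.
by rewrite lee_fin ler10.
Qed.

(** If the mean m were outside the interval, all values of [f] would lie strictly on one side of m,
    and f - m would have a nonzero integral. This places the limit point of the means inside the
    open box, where B is continuous. *)
Lemma mean_in_interval (I : set R) (f : R -> R) (C : R) : is_interval I ->
  measurable_fun [set: R] f -> (forall x, `|f x| <= C) -> (forall x, I (f x)) ->
  I (\int[N]_x f x).
Proof.
move=> iI mf fC fI; apply: contrapT => nI; set m := \int[N]_x f x in nI.
have if_ := normal_bounded_integrable mf fC.
have im : N.-integrable [set: R] (EFin \o cst m).
  exact: (finite_measure_integrable_cst N _ measurableT).
have m_le x : `|f x - m| <= C + `|m|.
  by apply: le_trans (ler_normB _ _) _; rewrite lerD2r.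
have fm x : f x != m by apply: contra_notN nI => /eqP <-.
have [[x xm]|/forallNP lem] := pselect (exists x, m < f x).
  have gtm y : 0 < f y - m.
    rewrite subr_gt0; have [//|ym|ym] := ltgtP m (f y); last by have := fm y; rewrite ym eqxx.
    by case: nI; apply: (iI _ _ (fI y) (fI x)); rewrite !ltW.
  have := normal_Rintegral_gt0 (measurable_funB mf (measurable_cst m)) m_le gtm.
  by rewrite RintegralB// (Rintegral_cst_probability N) subrr ltxx.
have ltm y : 0 < m - f y.
  rewrite subr_gt0 lt_neqAle fm leNgt; apply/negP; exact: lem.
have m_le' x : `|m - f x| <= C + `|m| by rewrite distrC.
have := normal_Rintegral_gt0 (measurable_funB (measurable_cst m) mf) m_le' ltm.
by rewrite RintegralB// (Rintegral_cst_probability N) subrr ltxx.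
Qed.

End means.

Section truncation.
Context {R : realType}.

Lemma admissible_le (L L' al be : R) (f g : R -> R) : L <= L' ->
  admissible L al be f g -> admissible L' al be f g.
Proof.
move=> LL [H1 H2 H3 H4]; split => // [x y|x|x y].
- by apply: le_trans (H2 x y) _; rewrite ler_wpM2r.
- exact: le_trans (H3 x) LL.
- by apply: le_trans (H4 x y) _; rewrite ler_wpM2r// sqr_ge0.
Qed.

(* A smooth substitute for truncation: for smooth [u], the function
   [u \o clamp M] takes values in a compact set and has bounded derivatives. *)
Definition clamp (M t : R) : R := sin (t / M) * M.

Lemma clamp_bound (M t : R) : 0 <= M -> `|clamp M t| <= M.
Proof.
by move=> M0; rewrite normrM (ger0_norm M0) ler_piMl// sin_max.
Qed.

Lemma is_derive_sin_scale (c t : R) :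
  is_derive t 1 (fun t : R => sin (t * c)) (cos (t * c) * c).
Proof.
exact: (@is_derive1_comp _ sin (fun t : R => t * c) _ _ _ _ (is_derive_mulr _ _)).
Qed.

Lemma is_derive_cos_scale (c t : R) :
  is_derive t 1 (fun t : R => cos (t * c)) (- sin (t * c) * c).
Proof.
exact: (@is_derive1_comp _ cos (fun t : R => t * c) _ _ _ _ (is_derive_mulr _ _)).
Qed.

Lemma is_derive_clamp (M t : R) : M != 0 ->
  is_derive t 1 (clamp M) (cos (t / M)).
Proof.
move=> M0; rewrite (_ : cos (t / M) = M * (cos (t * M^-1) * M^-1)); last by field.
exact: (@is_derive1_comp _ (fun r : R => r * M) (fun t : R => sin (t * M^-1)) _ _ _
  (is_derive_mulr _ _) (is_derive_sin_scale _ _)).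
Qed.

(** The class estimate for sin at 0 reads |sin x - x| <= x^2, whence |clamp M t - t| <= t^2 / M. *)
Lemma cvg_clamp (t : R) : clamp m.+1%:R t @[m --> \oo] --> t.
Proof.
have [_ _ _ H] : admissible 1 (-1) 1 (@sin R) (@cos R).
  apply: (@admissible_C2 _ _ _ _ _ _ (fun x => - sin x)) => x.
  - by rewrite sin_geN1 sin_le1.
  - exact: cos_max.
  - by rewrite normrN sin_max.
apply/cvgrPdistC_le => e e0.
have t1 : 0 < t ^+ 2 + 1 by rewrite ltr_wpDl// sqr_ge0.
have et : 0 < e / (t ^+ 2 + 1) by rewrite divr_gt0.
near=> m.
have m0 : 0 < m.+1%:R :> R by rewrite ltr0n.
have mM : (m.+1%:R : R) != 0 by rewrite gt_eqF.
have := H 0 (t / m.+1%:R); rewrite add0r sin0 cos0 subr0 !mul1r => Ht.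
rewrite (_ : _ - t = m.+1%:R * (sin (t / m.+1%:R) - t / m.+1%:R)); last first.
  by rewrite /clamp; field.
rewrite normrM gtr0_norm//; apply: (@le_trans _ _ (m.+1%:R * (t / m.+1%:R) ^+ 2)).
  by rewrite ler_wpM2l// ltW.
rewrite (_ : _ * _ = t ^+ 2 * m.+1%:R^-1); last by field.
apply: (@le_trans _ _ ((t ^+ 2 + 1) * m.+1%:R^-1)).
  by rewrite ler_wpM2r ?invr_ge0 ?ltW// ltrDl.
rewrite -ler_pdivlMl// mulrC.
near: m; by apply: filterS (near_infty_natSinv_lt (PosNum et)) => m /ltW.
Unshelve. all: by end_near. Qed.

Lemma smooth_is_derive (u : R -> R) m (t : R) : smooth u ->
  is_derive t 1 (u^`(m))%classic ((u^`(m.+1))%classic t).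
Proof.
by move=> su; rewrite derive1nS derive1E; apply: DeriveDef => //; exact: su.
Qed.

Lemma smooth_continuous (u : R -> R) m : smooth u -> continuous (u^`(m))%classic.
Proof.
by move=> su t; apply/differentiable_continuous/derivable1_diffP; exact: su.
Qed.

Let bounded_segment (h : R -> R) (M : R) : continuous h ->
  exists2 C, 0 <= C & forall x, `|x| <= M -> `|h x| <= C.
Proof.
move=> ch; have ch' : {within `[- M, M], continuous h} by exact: continuous_subspaceT.
have [C [_ CK]] := compact_bounded (continuous_compact ch' (@segment_compact _ _ _)).
exists (`|C| + 1); first by rewrite addr_ge0.
move=> x; rewrite ler_norml => xM; apply: CK; last by exists x => //; rewrite /= in_itv.
by rewrite ltr_pwDr// ler_norm.
Qed.

Lemma admissible_clamp (I : set R) (u : R -> R) (M : R) : is_interval I ->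
  smooth u -> (forall t, I (u t)) -> 1 <= M ->
  exists L al be g, [/\ I al, I be & admissible L al be (fun t => u (clamp M t)) g].
Proof.
move=> iI su uI M1; have M0 : 0 < M by exact: lt_le_trans M1.
have cu : continuous u by exact: (smooth_continuous (m := 0) su).
have cu' : {within `[- M, M], continuous u} by exact: continuous_subspaceT.
have MM : - M <= M by rewrite ge0_cp// ltW.
have [cmax _ hmax] := EVT_max MM cu'.
have [cmin _ hmin] := EVT_min MM cu'.
have inM t : clamp M t \in `[- M, M] by rewrite in_itv/= -ler_norml clamp_bound// ltW.
have [C1 C10 H1] := bounded_segment M (smooth_continuous (m := 1) su).
have [C2 C20 H2] := bounded_segment M (smooth_continuous (m := 2) su).
have cM t : `|clamp M t| <= M by exact/clamp_bound/ltW.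
pose u1 := (u^`(1))%classic; pose u2 := (u^`(2))%classic.
(* The end points are the extrema of [u] on [-M, M]; being attained, they belong to [I]. The second
   derivative is bounded by C1 / M + C2, and M >= 1. *)
exists (C1 + C2), (u cmin), (u cmax), (fun t => u1 (clamp M t) * cos (t / M)).
split=> //.
have M0' : M != 0 by rewrite gt_eqF.
have d1 (t : R) : is_derive t 1 (fun t => u (clamp M t)) (u1 (clamp M t) * cos (t / M)).
  exact: (@is_derive1_comp _ u (clamp M) _ _ _
    (smooth_is_derive 0 _ su) (is_derive_clamp _ M0')).
have d2 (t : R) : is_derive t 1 (fun t => u1 (clamp M t) * cos (t / M))
    (u1 (clamp M t) * (- sin (t / M) / M) +
     cos (t / M) * (u2 (clamp M t) * cos (t / M))).
  exact: (@is_deriveM _ _ (fun t => u1 (clamp M t)) (fun t => cos (t / M)) _ _ _ _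
    (@is_derive1_comp _ u1 (clamp M) _ _ _
      (smooth_is_derive 1 _ su) (is_derive_clamp _ M0'))
    (is_derive_cos_scale _ _)).
have range t : u cmin <= u (clamp M t) <= u cmax by rewrite hmin// hmax.
have b1 t : `|u1 (clamp M t) * cos (t / M)| <= C1 + C2.
  rewrite normrM -[leRHS]mulr1; apply: ler_pM => //; last exact: cos_max.
  by apply: (le_trans (H1 _ (cM t))); rewrite lerDl.
apply: (admissible_C2 range d1 d2 b1) => t.
apply: le_trans (ler_normD _ _) _; rewrite !normrM normrN; apply: lerD.
  rewrite -[leRHS]mulr1; apply: ler_pM => //; first exact: H1.
  rewrite -[leRHS]mulr1; apply: ler_pM => //; first exact: sin_max.
  by rewrite gtr0_norm ?invr_gt0// invf_le1.
rewrite -[leRHS]mul1r; apply: ler_pM => //; first exact: cos_max.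
by rewrite -[leRHS]mulr1; apply: ler_pM => //; [exact: H2|exact: cos_max].
Qed.

End truncation.

(** * Test functions for the sign of the quadratic form *)

Section sine_test_functions.
Context {R : realType}.

Lemma smooth_sine (q b s : R) : smooth (fun t => q + sin (s * t) * b).
Proof.
(* A family stable under differentiation, so that every iterated derivative stays in it. *)
pose F c0 c1 c2 (t : R) : R := c0 + (sin (t * s) * c1 + cos (t * s) * c2).
have dF c0 c1 c2 (t : R) :
    is_derive t 1 (F c0 c1 c2) (0 + (cos (t * s) * s * c1 + - sin (t * s) * s * c2)).
  apply: is_deriveD; apply: is_deriveD.
    rewrite mulrC; exact: (@is_derive1_comp _ (fun r : R => r * c1) (fun t : R => sin (t * s))
      _ _ _ (is_derive_mulr _ _) (is_derive_sin_scale _ _)).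
  rewrite mulrC; exact: (@is_derive1_comp _ (fun r : R => r * c2) (fun t : R => cos (t * s))
    _ _ _ (is_derive_mulr _ _) (is_derive_cos_scale _ _)).
have FE m : exists c0 c1 c2, (fun t => q + sin (s * t) * b)^`(m)%classic = F c0 c1 c2.
  elim: m => [|m [c0 [c1 [c2 ih]]]].
    by exists q, b, 0; apply/funext => t; rewrite /F mulr0 addr0 (mulrC t).
  exists 0, (- s * c2), (s * c1); rewrite derive1nS ih; apply/funext => t.
  rewrite derive1E; have dt := dF c0 c1 c2 t; rewrite derive_val /F; ring.
move=> m t; have [c0 [c1 [c2 ->]]] := FE m.
by have [] := dF c0 c1 c2 t.
Qed.

Lemma admissible_sine (q b : R) :
  admissible `|b| (q - `|b|) (q + `|b|) (fun t => q + sin t * b) (fun t => cos t * b).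
Proof.
have d1 (t : R) : is_derive t 1 (fun t : R => q + sin t * b) (cos t * b).
  rewrite -[cos t * b]add0r; apply: is_deriveD; rewrite mulrC.
  exact: (@is_derive1_comp _ (fun r : R => r * b) sin _ _ _ (is_derive_mulr _ _) (is_derive_sin _)).
have d2 (t : R) : is_derive t 1 (fun t : R => cos t * b) (- sin t * b).
  rewrite mulrC.
  exact: (@is_derive1_comp _ (fun r : R => r * b) cos _ _ _ (is_derive_mulr _ _) (is_derive_cos _)).
have bnd (x : R) : `|x| <= 1 -> `|x * b| <= `|b|.
  by move=> x1; rewrite normrM ler_piMl.
apply: (admissible_C2 _ d1 d2) => t.
- have := bnd _ (sin_max t); rewrite ler_norml => /andP[l u].
  by rewrite !lerD2l l u.
- exact/bnd/cos_max.
- by apply: bnd; rewrite normrN sin_max.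
Qed.

End sine_test_functions.

Lemma quadratic_schurE (R : realType) (k n : nat) (A : 'M[R]_(k, n))
    (B : 'rV[R]_n -> R) (u : 'rV[R]_n) (v : 'cV[R]_n) :
  (v^T *m schur (A^T *m A) (Hess B u) *m v) 0 0 =
  schur_form B (fun j => col j A) (fun j => v j 0) u.
Proof.
rewrite mxE /schur_form; apply: eq_bigr => j _.
rewrite mxE mulr_suml; apply: eq_bigr => i _.
rewrite !mxE (_ : dot _ _ = \sum_l A^T i l * A l j); first by ring.
by apply: eq_bigr => l _; rewrite !mxE mulrC.
Qed.

(** * The two implications *)

Section main.
Context {R : realType} {k n : nat}.
Notation N := (@normal_prob R 0 1).
Notation G := (@gaussian_measure R k).
Variables (I : 'I_n -> set R) (B : 'rV[R]_n -> R) (a : 'I_n -> 'cV[R]_k).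
Hypothesis oI : forall j, open (I j).
Hypothesis iI : forall j, is_interval (I j).
Hypothesis sB : smooth_on (box I) B.
Hypothesis bB : locally_bounded_on (box I) B.
Hypothesis n_gt0 : (0 < n)%N.
Hypothesis unit_a : forall j, enorm (a j) = 1.

Lemma gaussian_jensen_smooth (u : 'I_n -> R -> R) :
  (forall p v, box I p -> schur_form B a v p <= 0) ->
  (forall j, [/\ smooth (u j), bounded_fun (u j) & forall t, I j (u j t)]) ->
  \int[G]_x B (\row_j u j (dot (a j) (vec_of x))) <=
  B (\row_j \int[N]_t u j t).
Proof.
move=> neg uP.
have uI j t : I j (u j t) by have [_ _] := uP j; exact.
have su j : smooth (u j) by have [] := uP j.
have cu j : continuous (u j) by exact: (smooth_continuous (m := 0)).
have /choice[C uC] : forall j, exists C : R, forall t, `|u j t| <= C.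
  move=> j; have [_ [M [_ MB]] _] := uP j.
  by exists (`|M| + 1) => t; apply: MB => //; rewrite ltr_pwDr// ler_norm.
(* The values of the [u j] may accumulate at the ends of the intervals, where compactness says
   nothing about B; local boundedness supplies the dominating constant. It serves the truncations
   too, since they only take values of the [u j]. *)
have [CB uB] : exists CB : R, forall t : 'I_n -> R, `|B (\row_j u j (t j))| <= CB.
  pose S := [set \row_j u j (t j) | t in [set: 'I_n -> R]].
  have SI : S `<=` box I by move=> _ [t _ <-] j; rewrite mxE.
  have bS : bounded_set S.
    exists (\sum_j `|C j|); split; first exact: num_real.
    move=> M CM _ [t _ <-]; rewrite /Num.norm/= mx_normrE.
    have M0 : 0 <= M by apply: le_trans (ltW CM); exact: sumr_ge0.
    apply: bigmax_le => // -[i j] _; rewrite mxE /=.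
    apply: le_trans (uC _ _) _; apply: le_trans (ler_norm _) _.
    by apply: le_trans (ltW CM); rewrite (bigD1 j)//= lerDl sumr_ge0.
  have [M [_ MB]] := bB SI bS.
  exists (`|M| + 1) => t; apply: MB; last by exists t.
  by rewrite ltr_pwDr// ler_norm.
have cB p : box I p -> {for p, continuous B} by move=> /(sB [::])[].
pose um m j (t : R) := u j (clamp m.+1%:R t).
have cum m j : continuous (um m j).
  move=> t; apply: (@continuous_comp _ _ _ (clamp m.+1%:R) (u j)); last exact: cu.
  apply/differentiable_continuous/derivable1_diffP.
  by have [] := @is_derive_clamp R m.+1%:R t (lt0r_neq0 (ltr0Sn _ _)).
have step m : \int[G]_x B (\row_j um m j (dot (a j) (vec_of x))) <=
    B (\row_j \int[N]_t um m j t).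
  have m1 : 1 <= m.+1%:R :> R by rewrite ler1n.
  have /choice[c cP] : forall j, exists c : R * R * R * (R -> R),
      [/\ I j c.1.1.2, I j c.1.2 & admissible c.1.1.1 c.1.1.2 c.1.2 (um m j) c.2].
    move=> j; have [L [al [be [g H]]]] := admissible_clamp (@iI j) (su j) (uI j) m1.
    by exists (L, al, be, g).
  (* The class requires one constant for all indices; the individual ones are nonnegative, so their
     sum dominates each. *)
  pose L := \sum_j (c j).1.1.1.
  have adm j : admissible L (c j).1.1.2 (c j).1.2 (um m j) (c j).2.
    have [_ _ H] := cP j; apply: admissible_le H.
    rewrite /L (bigD1 j)//= lerDl sumr_ge0// => i _.
    by have [_ _ H] := cP i; exact: admissible_ge0 H.
  have Ial j : I j (c j).1.1.2 by have [] := cP j.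
  have Ibe j : I j (c j).1.2 by have [] := cP j.
  have := gaussian_jensen_admissible oI iI sB Ial Ibe n_gt0 unit_a neg adm.
  rewrite addr0; under eq_Rintegral do under eq_mx do rewrite mul1r.
  move=> /le_trans; apply; rewrite le_eqVlt; apply/orP; left; apply/eqP; congr B.
  by apply/rowP => j; rewrite !mxE; apply: eq_Rintegral => z _; rewrite mul1r.
have cv j t : um m j t @[m --> \oo] --> u j t.
  apply: (cvg_comp (fun m => clamp m.+1%:R t) (u j)); first exact: cvg_clamp.
  exact: cu.
have mean_cvg j : \int[N]_t um m j t @[m --> \oo] --> \int[N]_t u j t.
  apply: (@cvg_Rintegral_bounded _ (measurableTypeR R) R N _ _ (C j)) => [m|m x|x].
  - exact: continuous_measurable_fun.
  - exact: uC.
  - exact: cv.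
have lhs : \int[G]_x B (\row_j um m j (dot (a j) (vec_of x))) @[m --> \oo] -->
    \int[G]_x B (\row_j u j (dot (a j) (vec_of x))).
  apply: (@cvg_Rintegral_bounded _ _ R G _ _ CB) => [m|m x|x].
  - by apply: (@measurable_composite _ _ _ I B a sB) => // j t; exact: uI.
  - exact: (uB (fun j => clamp m.+1%:R (dot (a j) (vec_of x)))).
  - apply: (cvg_comp (fun m => \row_j um m j (dot (a j) (vec_of x))) B).
      by apply: cvg_row => j; exact: cv.
    by apply: cB => j; rewrite mxE.
have rhs : B (\row_j \int[N]_t um m j t) @[m --> \oo] --> B (\row_j \int[N]_t u j t).
  apply: (cvg_comp (fun m => \row_j \int[N]_t um m j t) B).
    by apply: cvg_row => j; exact: mean_cvg.
  apply: cB => j; rewrite mxE; apply: (mean_in_interval (@iI j) _ (uC j)) => //.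
  exact: continuous_measurable_fun.
by apply: (ler_cvg_to lhs rhs); exact: nearW.
Qed.

Lemma schur_form_le0 :
  (forall u : 'I_n -> R -> R,
    (forall j, [/\ smooth (u j), bounded_fun (u j) & forall t, I j (u j t)]) ->
    \int[G]_x B (\row_j u j (dot (a j) (vec_of x))) <=
    B (\row_j \int[N]_t u j t)) ->
  forall p v, box I p -> schur_form B a v p <= 0.
Proof.
move=> jensen p v pI.
(* The amplitude [d] is small enough for p_j + d v_j sin to range in a closed segment inside I_j. *)
have [d d0 dI] : exists2 d, 0 < d & forall j,
    I j (p 0 j - `|d * v j|) /\ I j (p 0 j + `|d * v j|).
  have nd (e : R) j : \forall d \near (0 : R)^'+, I j (p 0 j + e * `|d * v j|).
    have cvd : (fun d : R => p 0 j + e * `|d * v j|) @ (0 : R) -->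
        p 0 j + e * `|0 * v j|.
      apply: cvgD; first exact: cvg_cst.
      apply: cvgM; first exact: cvg_cst.
      by apply: cvg_norm; apply: cvgM; [exact: cvg_id|exact: cvg_cst].
    apply: cvg_within; apply: cvd; rewrite mul0r normr0 mulr0 addr0.
    by apply: open_nbhs_nbhs; split; [exact: oI|exact: pI].
  have ndI : \forall d \near (0 : R)^'+, forall j,
      I j (p 0 j - `|d * v j|) /\ I j (p 0 j + `|d * v j|).
    apply: filter_forall => j; apply: filterS2 (nd (-1) j) (nd 1 j) => d.
    by rewrite mulN1r mul1r.
  by have [d [dI d0]] := filter_ex (filterI ndI (nbhs_right_gt 0)); exists d.
pose b j := d * v j.
pose L := \sum_j `|b j|.
pose f j (t : R) := p 0 j + sin t * b j.
pose g j (t : R) := cos t * b j.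
have fg j : admissible L (p 0 j - `|b j|) (p 0 j + `|b j|) (f j) (g j).
  apply: admissible_le (admissible_sine _ _).
  by rewrite /L (bigD1 j)//= lerDl sumr_ge0.
have Ial j : I j (p 0 j - `|b j|) by have [] := dI j.
have Ibe j : I j (p 0 j + `|b j|) by have [] := dI j.
have [C C0 step] := one_step L oI iI sB Ial Ibe n_gt0 unit_a.
(* The assumed inequality gives J(s) <= Q(s), so by [one_step] the quadratic term cannot exceed the
   cubic error. The slopes at 0 are d v_j, hence the factor d^2. *)
have S_le s : 0 <= s <= 1 ->
    s ^+ 2 / 2 * normal_variance * (d ^+ 2 * schur_form B a v p) <= C * s ^+ 3.
  move=> s01; have H := step f g s fg s01.
  have J := jensen (fun j t => f j (s * t)) _.
  have {}J : \int[G]_x B (\row_j f j (s * dot (a j) (vec_of x))) <=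
      B (\row_j \int[N]_t f j (s * t)).
    apply: J => j; split; first exact: smooth_sine.
      exists (`|p 0 j - `|b j| | + `|p 0 j + `|b j| |); split; first exact: num_real.
      by move=> M CM t _; apply: le_trans (ltW CM); exact: (admissible_bound (fg j)).
    move=> t; have [H1 _ _ _] := fg j; apply: (iI (Ial j) (Ibe j)); exact: H1.
  rewrite (_ : \row_j f j 0 = p) in H; last first.
    by apply/rowP => j; rewrite mxE /f sin0 mul0r addr0.
  rewrite (_ : schur_form B a (g^~ 0) p = d ^+ 2 * schur_form B a v p) in H; last first.
    rewrite /schur_form mulr_sumr; apply: eq_bigr => j _.
    rewrite mulr_sumr; apply: eq_bigr => i _.
    by rewrite /g /b cos0; ring.
  by move: H => /ler_normlP[H _]; lra.
rewrite leNgt; apply/negP => S0.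
pose c : R := normal_variance / 2 * (d ^+ 2 * schur_form B a v p).
have c0 : 0 < c.
  by rewrite /c !mulr_gt0 ?normal_variance_gt0 ?exprn_gt0.
(* Were the form positive, dividing by s^2 would give c <= C s, against C s < (C + 1) s <= c. *)
pose s := Num.min 1 (c / (C + 1)).
have C1 : 0 < C + 1 by rewrite ltr_wpDl.
have s0 : 0 < s by rewrite lt_min ltr01 divr_gt0.
have s1 : 0 <= s <= 1 by rewrite ltW//= ge_min lexx.
have := S_le s s1.
rewrite (_ : _ * (d ^+ 2 * _) = s ^+ 2 * c); last by rewrite /c; field.
rewrite (_ : C * s ^+ 3 = s ^+ 2 * (C * s)); last by ring.
rewrite ler_pM2l ?exprn_gt0// leNgt => /negP; apply.
apply: (@lt_le_trans _ _ ((C + 1) * s)); first by rewrite ltr_pM2r// ltrDl.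
by rewrite mulrC -ler_pdivlMr// ge_min lexx orbT.
Qed.

End main.

Theorem theorem1 (R : realType) (k n : nat) (hk : (1 <= k)%N) (hkn : (k <= n)%N)
    (I : 'I_n -> set R)
    (hI : forall j, open (I j) /\ is_interval (I j))
    (B : 'rV[R]_n -> R)
    (hBsmooth : smooth_on (box I) B)
    (hBbounded : locally_bounded_on (box I) B)
    (A : 'M[R]_(k, n)) (hrank : \rank A = k)
    (hunit : forall j, enorm (col j A) = 1) :
  (forall u, box I u -> negsemidef (schur (A^T *m A) (Hess B u)))
  <->
  (forall u : 'I_n -> R -> R,
     (forall j, [/\ smooth (u j), bounded_fun (u j)
                  & forall t, I j (u j t)]) ->
     \int[@gaussian_measure R k]_x
        B (\row_j u j (dot (col j A) (vec_of x)))
     <= B (\row_j \int[@normal_prob R 0 1]_t u j t)).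
Proof.
have oI j : open (I j) by have [] := hI j.
have iI j : is_interval (I j) by have [] := hI j.
have n_gt0 : (0 < n)%N by exact: leq_trans hk hkn.
split=> [neg u uP|jensen u uI v].
  apply: (gaussian_jensen_smooth oI iI hBsmooth hBbounded n_gt0 hunit) uP => p v pI.
  have := neg p pI (\col_j v j); rewrite quadratic_schurE.
  by congr (schur_form _ _ _ _ <= 0); apply/funext => j; rewrite mxE.
rewrite quadratic_schurE.
exact: (schur_form_le0 oI iI hBsmooth n_gt0 hunit jensen).
Qed.
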